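(* Let $a>b\geq 2$ be natural numbers, $A=\{0,1,\dots,a-1\}$, $B=\{0,1,\dots,b-1\}$, let $\Omega\subset (A\times B)^{\mathbb{N}}$ be a non-empty subshift, $\pi:(A\times B)^{\mathbb N}\to B^{\mathbb N}$ the natural projection, $\Omega'=\pi(\Omega)$, and let $(X_\Omega,\sigma)$ be the associated Bedford--McMullen carpet system, equipped with the metric $d$. Then $$\mathrm{mdim}_{\mathrm A}(X_\Omega,\sigma,d)=\frac{h_{\mathrm{top}}(\Omega\vert\Omega',\sigma)}{\log a}+\frac{h_{\mathrm{top}}(\Omega',\sigma)}{\log b}.$$ Moreover, for all $\theta\in(0,1)$, $\mathrm{mdim}_{\mathrm A}^{\theta}(X_\Omega,\sigma,d)$ equals $$\min\left\{\frac{\mathrm{mdim}_{\mathrm M}(X_\Omega,\sigma,d)-\theta\left(\left(\frac{1}{\log a}-\frac{1}{\log b}\right)h_{\mathrm{top}}(\Omega\vert\Omega',\sigma)+\frac{h_{\mathrm{top}}(\Omega,\sigma)}{\log b}\right)}{1-\theta},\ \mathrm{mdim}_{\mathrm A}(X_\Omega,\sigma,d)\right\}.$$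
   Context: $\mathbb N=\{1,2,\dots\}$ and $\log$ is the natural logarithm. General definitions. Let $(X,d)$ be a compact metric space and $T:X\to X$ continuous. For $M\in\mathbb N$ put $d_M(x,y)=\max_{0\le m<M}d(T^mx,T^my)$ and $B_{d_M}(x,r)=\{y\in X: d_M(x,y)\le r\}$. For a metric $d$, a subset $K$ and $\varepsilon>0$, $N_d(K,\varepsilon)$ is the minimal $n\ge1$ such that $K$ can be covered by $n$ open sets of $d$-diameter at most $\varepsilon$. For $0<\rho<r$ let $$S(X,r,\rho)=\lim_{M\to\infty}\frac1M\sup_{x\in X}\log N_{d_M}(B_{d_M}(x,r),\rho)$$ (the limit exists by sub-additivity). The mean Assouad dimension is $$\mathrm{mdim}_{\mathrm A}(X,T,d)=\inf\{s>0:\exists C>0\ \forall\, 0<\rho<r,\ e^{S(X,r,\rho)}\le C(r/\rho)^s\},$$ and for $\theta\in(0,1)$ the mean Assouad spectrum is $$\mathrm{mdim}_{\mathrm A}^\theta(X,T,d)=\inf\{s>0:\exists C>0\ \forall\, 0<r<1,\ e^{S(X,r,r^{1/\theta})}\le C(r/r^{1/\theta})^s\}$$ (with $\inf\emptyset=+\infty$). The upper and lower metric mean dimensions are the $\limsup$ and $\liminf$ as $\varepsilon\to0$ of $\lim_{M\to\infty}\frac{\log N_{d_M}(X,\varepsilon)}{M\log(1/\varepsilon)}$; if they coincide the common value is the metric mean dimension $\mathrm{mdim}_{\mathrm M}(X,T,d)$. For the systems $(X_\Omega,\sigma,d)$ below it is known (Tsukamoto) that the metric mean dimension exists. The topological entropy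 is $h_{\mathrm{top}}(X,T)=\lim_{\varepsilon\to0}\lim_{M\to\infty}\frac1M\log N_{d_M}(X,\varepsilon)$. For a factor map $\pi:(X,T)\to(Y,S)$ (continuous surjection with $\pi T=S\pi$) the topological conditional entropy is $$h_{\mathrm{top}}(X,T\vert Y,S)=\lim_{\varepsilon\to0}\lim_{M\to\infty}\frac{\sup_{y\in Y}\log N_{d_M}(\pi^{-1}(y),\varepsilon)}{M}.$$ Both entropies are independent of the choice of compatible metric. Carpet systems. $\sigma$ denotes the left shift on $(A\times B)^{\mathbb N}$ and on $B^{\mathbb N}$. A subshift is a closed subset $\Omega$ with $\sigma(\Omega)\subset\Omega$. $\pi$ also denotes its restriction $\Omega\to\Omega'=\pi(\Omega)$, which is a factor map $(\Omega,\sigma)\to(\Omega',\sigma)$, and $h_{\mathrm{top}}(\Omega\vert\Omega',\sigma)$ denotes its topological conditional entropy. The space $[0,1]^{\mathbb N}\times[0,1]^{\mathbb N}$ carries the metric $$d((x,y),(x',y'))=\sum_{n=1}^\infty2^{-n}\max\{|x_n-x'_n|,|y_n-y'_n|\}$$ and the shift $\sigma((x_n)_n,(y_n)_n)=((x_{n+1})_n,(y_{n+1})_n)$. The Bedford--McMullen carpet system is $$X_\Omega=\left\{\left(\sum_{m=1}^\infty\frac{x_m}{a^m},\sum_{m=1}^\infty\frac{y_m}{b^m}\right)\in[0,1]^{\mathbb N}\times[0,1]^{\mathbb N}:\ (x_m,y_m)\in\Omega\text{ for all }m\ge1\right\},$$ where $x_m\in A^{\mathbb N}$, $y_m\in B^{\mathbb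 N}$ are sequences (a point of $(A\times B)^{\mathbb N}$ being identified with a pair in $A^{\mathbb N}\times B^{\mathbb N}$) and the sums are taken in $\ell^\infty$. It is a compact subset with $\sigma(X_\Omega)\subset X_\Omega$. *)

(* Defs.v *)
From HB Require Import structures.
From mathcomp Require Import all_boot all_order all_algebra.
From mathcomp Require Import all_classical all_reals all_analysis.
Set Implicit Arguments.
Unset Strict Implicit.
Unset Printing Implicit Defensive.
Import Order.TTheory GRing.Theory Num.Theory.
Import numFieldNormedType.Exports.
Local Open Scope classical_set_scope.
Local Open Scope ring_scope.

(* A dynamical system (X, T, d) is given by an ambient type U, a subset X of U,
   a map T : U -> U with T(X) included in X, and d : U -> U -> R which is a
   metric on X. Only the values of T and d on X matter. Quantities that may be
   infinite live in \bar R. *)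

(* d_M(x,y) = max_{m < M} d(T^m x, T^m y); the default 0 is harmless as d >= 0. *)
Definition bowen_dist (R : realType) (U : Type) (T : U -> U)
    (d : U -> U -> R) (M : nat) (x y : U) : R :=
  \big[Num.max/0]_(m < M) d (iter m T x) (iter m T y).

Definition cball_in (R : realType) (U : Type) (X : set U) (d : U -> U -> R)
    (x : U) (r : R) : set U :=
  [set y | X y /\ d x y <= r].

Definition open_in (R : realType) (U : Type) (X : set U) (d : U -> U -> R)
    (V : set U) : Prop :=
  V `<=` X /\
  forall x, V x -> exists2 e : R, 0 < e & forall y, X y -> d x y < e -> V y.

Definition diam_le (R : realType) (U : Type) (d : U -> U -> R) (V : set U)
    (e : R) : Prop :=
  forall x y, V x -> V y -> d x y <= e.

Definition coverable (R : realType) (U : Type) (X : set U) (d : U -> U -> R)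
    (K : set U) (e : R) (n : nat) : Prop :=
  exists V : 'I_n -> set U,
    (forall i, open_in X d (V i) /\ diam_le d (V i) e) /\
    K `<=` \bigcup_i V i.

(* N_d(K, e); it is +oo if there is no finite cover, which does not happen when
   (X, d) is compact and e > 0. *)
Definition covering_number (R : realType) (U : Type) (X : set U)
    (d : U -> U -> R) (K : set U) (e : R) : \bar R :=
  ereal_inf [set (n%:R)%:E | n in [set n | (1 <= n)%N /\ coverable X d K e n]].

(* log N_{d_M}(K, e) *)
Definition log_cover (R : realType) (U : Type) (X : set U) (T : U -> U)
    (d : U -> U -> R) (M : nat) (K : set U) (e : R) : \bar R :=
  lne (covering_number X (bowen_dist T d M) K e).

(* S(X, r, rho) *)
Definition local_growth (R : realType) (U : Type) (X : set U) (T : U -> U)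
    (d : U -> U -> R) (r rho : R) : \bar R :=
  limn (fun M : nat => (M%:R^-1)%:E *
    ereal_sup [set log_cover X T d M (cball_in X (bowen_dist T d M) x r) rho
              | x in X])%E.

Definition mdimA (R : realType) (U : Type) (X : set U) (T : U -> U)
    (d : U -> U -> R) : \bar R :=
  ereal_inf [set s%:E | s in [set s : R | 0 < s /\
    exists2 C : R, 0 < C & forall rho r : R, 0 < rho < r ->
      (expeR (local_growth X T d r rho) <= (C * (r / rho) `^ s)%:E)%E]].

Definition mdimA_spectrum (R : realType) (U : Type) (X : set U) (T : U -> U)
    (d : U -> U -> R) (theta : R) : \bar R :=
  ereal_inf [set s%:E | s in [set s : R | 0 < s /\
    exists2 C : R, 0 < C & forall r : R, 0 < r < 1 ->
      (expeR (local_growth X T d r (r `^ theta^-1))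
         <= (C * (r / r `^ theta^-1) `^ s)%:E)%E]].

Definition mdimM_at (R : realType) (U : Type) (X : set U) (T : U -> U)
    (d : U -> U -> R) (e : R) : \bar R :=
  limn (fun M : nat => log_cover X T d M X e * ((M%:R * ln e^-1)^-1)%:E)%E.

Definition upper_mdimM (R : realType) (U : Type) (X : set U) (T : U -> U)
    (d : U -> U -> R) : \bar R :=
  limf_esup (mdimM_at X T d) 0^'+.

Definition lower_mdimM (R : realType) (U : Type) (X : set U) (T : U -> U)
    (d : U -> U -> R) : \bar R :=
  limf_einf (mdimM_at X T d) 0^'+.

(* The common value of the upper and lower metric mean dimensions; an arbitrary
   value if they differ. *)
Definition mdimM (R : realType) (U : Type) (X : set U) (T : U -> U)
    (d : U -> U -> R) : \bar R :=
  get [set v | upper_mdimM X T d = v /\ lower_mdimM X T d = v].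

Definition htop (R : realType) (U : Type) (X : set U) (T : U -> U)
    (d : U -> U -> R) : \bar R :=
  lim ((limn (fun M : nat => (M%:R^-1)%:E * log_cover X T d M X e)%E)
       @[e --> 0^'+]).

(* h_top(X, T | Y, S) for a factor map p : X -> Y; neither S nor a metric on Y
   enters the formula. *)
Definition htop_cond (R : realType) (U W : Type) (X : set U) (T : U -> U)
    (d : U -> U -> R) (Y : set W) (p : U -> W) : \bar R :=
  lim ((limn (fun M : nat => (M%:R^-1)%:E *
          ereal_sup [set log_cover X T d M (X `&` p @^-1` [set y]) e
                    | y in Y])%E)
       @[e --> 0^'+]).

(* Sequences are indexed by nat: the n-th entry here (n >= 0) is the entry of
   index n + 1 in the usual notation with indices 1, 2, ... *)

Definition shift_seq (E : Type) (w : nat -> E) : nat -> E := fun n => w n.+1.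

(* A subshift of E^N, for the product of the discrete topologies. *)
Definition subshift (E : choiceType) (W : set (nat -> E)) : Prop :=
  closed (W : set {ptws nat -> discrete_topology E}) /\ @shift_seq E @` W `<=` W.

(* A metric inducing the product topology on E^N when E is finite; entropies of
   subshifts do not depend on the choice of such a metric. *)
Definition symb_dist (R : realType) (E : eqType) (w w' : nat -> E) : R :=
  limn (fun N : nat => \sum_(n < N) 2^-1 ^+ n.+1 * (w n != w' n)%:R : R).

(* The natural projection (A x B)^N -> B^N. *)
Definition proj2 (a b : nat) (w : nat -> 'I_a * 'I_b) : nat -> 'I_b :=
  fun n => (w n).2.

Definition shift_pair (R : realType) (p : (nat -> R) * (nat -> R)) :
    (nat -> R) * (nat -> R) :=
  (shift_seq p.1, shift_seq p.2).

Definition carpet_dist (R : realType) (p q : (nat -> R) * (nat -> R)) : R :=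
  limn (fun N : nat => \sum_(n < N)
    2^-1 ^+ n.+1 * Num.max `|p.1 n - q.1 n| `|p.2 n - q.2 n| : R).

(* X_Omega: the sequence of points (x_m, y_m) of Omega is z, and the two series
   converge in sup norm. Such points automatically lie in [0,1]^N x [0,1]^N. *)
Definition carpet (R : realType) (a b : nat)
    (Omega : set (nat -> 'I_a * 'I_b)) : set ((nat -> R) * (nat -> R)) :=
  [set p : (nat -> R) * (nat -> R) | exists z : nat -> nat -> 'I_a * 'I_b,
    [/\ forall m, Omega (z m),
        {uniform, (fun N n => \sum_(m < N)
          (nat_of_ord (z m n).1)%:R / a%:R ^+ m.+1 : R) @ \oo --> p.1}
      & {uniform, (fun N n => \sum_(m < N)
          (nat_of_ord (z m n).2)%:R / b%:R ^+ m.+1 : R) @ \oo --> p.2}]].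

Arguments shift_seq {E} w.
Arguments symb_dist R {E} w w'.
Arguments proj2 {a b} w.
Arguments shift_pair {R} p.
Arguments carpet_dist {R} p q.
Arguments carpet R {a b} Omega.

(* Main.v *)
Require Import Defs.
From HB Require Import structures.
From mathcomp Require Import all_boot all_order all_algebra.
From mathcomp Require Import all_classical all_reals all_analysis.
From mathcomp Require Import zify ring lra.
Import Order.TTheory GRing.Theory Num.Theory.
Import numFieldNormedType.Exports.
Local Open Scope classical_set_scope.
Local Open Scope ring_scope.
Set Implicit Arguments.
Unset Strict Implicit.
Unset Printing Implicit Defensive.

(** A point of the carpet is coded by a sequence [z] of points of [Omega]: level
    [m] of the code gives the [m]-th digits, in base [a] and base [b], of all the
    coordinates. Fix scales [rho <= r] and write [s = - ln r], [t = - ln rho]. A ball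
    of radius [r] for [d_M] fixes, in the first [M] coordinates, about [s / ln a]
    base-[a] digits and [s / ln b] base-[b] digits, up to neighbouring digit
    strings, of which there is a bounded number per coordinate. To cover the ball at
    scale [rho] one has to list the digits up to [t / ln a] and [t / ln b]. The levels
    are independent of each other, so the number of possibilities is a product
    over levels: a level with both digits fixed contributes nothing; a level whose
    second digits are fixed and whose first digits are needed contributes the words of [Omega] over a known word of
    the projection; a level with both digits free contributes all the words of
    [Omega]; a level at which only the second digits are still visible contributes
    the words of [Omega' = proj2 (Omega)]. Dividing logarithms by [M], one gets
    sums of the three entropies [hc], [h], [h'], and the bounded number of
    neighbours per coordinate becomes an additive constant. This gives
    ([local_growth_estimate])
      [S(X, r, rho) = (t - s) (hc / ln a + h' / ln b)
                      - max (0, t / ln a - s / ln b) (hc + h' - h) + O(1)].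

    Since [h <= hc + h'], the last product is nonnegative, and it vanishes when [t]
    is at most [s ln a / ln b]. Hence the best exponent for all pairs of scales is
    [hc / ln a + h' / ln b]. On the curve [rho = r ^ (1 / theta)] the formula is
    linear in [s], and its slope is the Assouad spectrum. For [r = 1] it gives the
    metric mean dimension [h / ln a + (1 / ln b - 1 / ln a) h'], and the formula
    of the theorem is obtained by expressing the slope through it.

    Three points need an argument besides the counting. The limits in [M] exist
    by Fekete's lemma ([cvg_rate], [local_growth_subadditive]). The sets of a cover
    have to be open, which is arranged by thickening ([coverable_of_codes]). And the
    upper bound sees the words over a finite word of the projection, while the
    conditional entropy counts the words over a point of [Omega']; a compactness
    argument shows that both have the same growth rate ([column_window],
    [rate_max_column]). *)

(** * Counting the values of a map on a set *)

(** Covers are counted through codes with finitely many values on an infinite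
    set of coded objects; [values P c] is the finite set of codes that occur. *)
Definition values (Z : Type) (I : finType) (P : set Z) (c : Z -> I) : {set I} :=
  [set i | `[< exists2 z, P z & c z = i >]].

Section Values.
Variables (Z : Type) (I : finType).
Implicit Types (P Q : set Z) (c : Z -> I).

Lemma valuesP P c i : reflect (exists2 z, P z & c z = i) (i \in values P c).
Proof. by rewrite inE; apply: asboolP. Qed.

Lemma mem_values P c z : P z -> c z \in values P c.
Proof. by move=> Pz; apply/valuesP; exists z. Qed.

Lemma card_values_subset P Q c : P `<=` Q -> (#|values P c| <= #|values Q c|)%N.
Proof.
move=> PQ; apply/subset_leq_card/fintype.subsetP => i /valuesP[z Pz <-].
by apply: mem_values; apply: PQ.
Qed.

Lemma card_values_gt0 P c : P !=set0 -> (0 < #|values P c|)%N.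
Proof. by move=> [z Pz]; apply/card_gt0P; exists (c z); apply: mem_values. Qed.

Lemma values_representatives P c : P !=set0 ->
  exists s : I -> Z, forall i, i \in values P c -> P (s i) /\ c (s i) = i.
Proof.
move=> [z0 _].
have /choice[s Hs] : forall i, exists z, i \in values P c -> P z /\ c z = i.
  move=> i; have [/valuesP[z Pz cz]|_] := boolP (i \in values P c).
    by exists z.
  by exists z0.
by exists s.
Qed.

Lemma card_values_le1 P c :
  (forall z z', P z -> P z' -> c z = c z') -> (#|values P c| <= 1)%N.
Proof.
move=> cc; apply/card_le1P => i /valuesP[z Pz <-] j.
rewrite !inE; apply/asboolP/eqP => [[z' Pz' <-]|->]; first exact: cc.
by exists z.
Qed.

End Values.

(** Used to compare two codes of the same objects, and, with [h] ranging over
    pairs or coarser codes below, to split a count into factors. *)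
Lemma card_values_determined (Z : Type) (I J : finType) (P : set Z)
    (c : Z -> I) (h : Z -> J) :
  (forall z z', P z -> P z' -> h z = h z' -> c z = c z') ->
  (#|values P c| <= #|values P h|)%N.
Proof.
move=> hc; have [P0|] := pselect (P !=set0); last first.
  move=> P0; suff -> : values P c = finset.set0 by rewrite cards0.
  apply/setP => i; rewrite finset.in_set0; apply/negbTE/negP => /valuesP[z Pz _].
  by apply: P0; exists z.
have [s sP] := values_representatives c P0.
rewrite -(card_in_imset (f := h \o s)); last first.
  move=> i j iP jP /= e; have [Pi <-] := sP _ iP; have [Pj <-] := sP _ jP.
  exact: hc.
apply/subset_leq_card/fintype.subsetP => _ /imsetP[i iP ->].
exact: (mem_values h (proj1 (sP _ iP))).
Qed.

Lemma card_values_inj (Z : Type) (I J : finType) (P : set Z)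
    (c : Z -> I) (h : Z -> J) :
  (forall z z', P z -> P z' -> h z = h z' -> c z = c z') ->
  (#|values P c| <= #|J|)%N.
Proof.
by move=> hc; apply: leq_trans (card_values_determined hc) (max_card _).
Qed.

Lemma card_values_pair (Z : Type) (I J K : finType) (P : set Z)
    (c : Z -> I) (h : Z -> J) (g : Z -> K) :
  (forall z z', P z -> P z' -> h z = h z' -> g z = g z' -> c z = c z') ->
  (#|values P c| <= #|values P h| * #|values P g|)%N.
Proof.
move=> hc; apply: (@leq_trans #|values P (fun z => (h z, g z))|).
  by apply: card_values_determined => z z' Pz Pz' [e1 e2]; apply: hc.
rewrite -cardsX; apply/subset_leq_card/fintype.subsetP => i /valuesP[z Pz <-].
by rewrite finset.in_setX /= !mem_values.
Qed.

Lemma card_values_fiber (Z : Type) (I J : finType) (P : set Z)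
    (c : Z -> I) (h : Z -> J) (N : nat) :
  (forall z0, P z0 -> (#|values [set z | P z /\ h z = h z0] c| <= N)%N) ->
  (#|values P c| <= #|values P h| * N)%N.
Proof.
move=> hN.
apply: (@leq_trans #|\bigcup_(j in values P h) values [set z | P z /\ h z = j] c|%SET).
  apply/subset_leq_card/fintype.subsetP => i /valuesP[z Pz <-].
  apply/bigcupP; exists (h z); first exact: mem_values.
  by apply/valuesP; exists z.
rewrite -sum_nat_const; apply: (@leq_trans
    (\sum_(j in values P h) #|values [set z | P z /\ h z = j] c|)).
  elim/big_rec2: _ => [|j n A _ An]; first by rewrite cards0.
  by apply: leq_trans (leq_card_setU _ _) _; rewrite leq_add2l.
by apply: leq_sum => j /valuesP[z Pz <-]; apply: hN.
Qed.

(** * Exponential growth rates of submultiplicative sequences *)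

Section Rate.
Variable R : realType.
Implicit Types u : nat -> R.

(** By Fekete's lemma the infimum is the limit when [u] is subadditive; in this
    form [rate u] is a lower bound for all [u n / n] at once. *)
Definition rate u : R := inf [set u n / n%:R | n in [set n | (0 < n)%N]].

Definition subadditive_seq u := forall m n, u (m + n)%N <= u m + u n.

Lemma subadditive_mul u q k s : subadditive_seq u ->
  u (q * k + s)%N <= q%:R * u k + u s.
Proof.
move=> subu; elim: q => [|q IH]; first by rewrite mul0r add0r.
rewrite mulSn -addnA; apply: le_trans (subu _ _) _.
by rewrite -natr1 mulrDl mul1r; lra.
Qed.

Lemma rate_lbound u n : (forall n, 0 <= u n) -> (0 < n)%N ->
  rate u * n%:R <= u n.
Proof.
move=> u0 n0; rewrite -ler_pdivlMr ?ltr0n//; apply: ge_inf; last by exists n.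
by exists 0 => _ [m _ <-]; rewrite divr_ge0.
Qed.

Lemma rate_ge0 u : (forall n, 0 <= u n) -> 0 <= rate u.
Proof.
move=> u0; apply: lb_le_inf; first by exists (u 1%N / 1%:R); exists 1%N.
by move=> _ [m _ <-]; rewrite divr_ge0.
Qed.

(** Fekete's lemma: if [u k / k] is nearly minimal, cutting a long interval into
    pieces of length [k] shows that [u n / n] is nearly minimal for large n. *)
Lemma cvg_rate u : (forall n, 0 <= u n) -> subadditive_seq u ->
  (fun n => u n / n%:R) @ \oo --> rate u.
Proof.
move=> u0 subu; apply/cvgrPdist_le => /= e e0.
have e2 : 0 < e / 2 by rewrite divr_gt0.
have hu : has_inf [set u n / n%:R | n in [set n | (0 < n)%N]].
  split; first by exists (u 1%N / 1%:R); exists 1%N.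
  by exists 0 => _ [m _ <-]; rewrite divr_ge0.
have [_ [k k0 <-] uk] := inf_adherent e2 hu.
rewrite -/(rate u) in uk; rewrite /= in k0.
pose B := \sum_(s < k) u s.
have B0 : 0 <= B by apply: sumr_ge0.
near=> n.
have n0 : (0 < n)%N by near: n; exists 1%N.
have n0R : 0 < n%:R :> R by rewrite ltr0n.
have k0R : 0 < k%:R :> R by rewrite ltr0n.
rewrite ler_distlC; apply/andP; split.
  apply: (@le_trans _ _ (rate u)); first by lra.
  by rewrite ler_pdivlMr ?ltr0n// rate_lbound.
rewrite ler_pdivrMr//.
have -> : u n = u (n %/ k * k + n %% k)%N by rewrite -divn_eq.
apply: le_trans (subadditive_mul _ _ _ subu) _.
have us : u (n %% k)%N <= B.
  by rewrite /B (bigD1 (Ordinal (ltn_pmod n k0)))//= lerDl sumr_ge0.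
have uq : (n %/ k)%N%:R * u k <= n%:R * (u k / k%:R).
  rewrite mulrCA mulrC ler_wpM2l// ler_pdivlMr// -natrM ler_nat.
  exact: leq_trunc_div.
have Bn : B <= e / 2 * n%:R.
  rewrite mulrC -ler_pdivrMr ?divr_gt0//; near: n.
  exact: nbhs_infty_ger.
have uk' : n%:R * (u k / k%:R) <= n%:R * (rate u + e / 2).
  by rewrite ler_wpM2l ?ler0n// ltW.
have E : (rate u + e) * n%:R = n%:R * (rate u + e / 2) + e / 2 * n%:R by lra.
lra.
Unshelve. all: by end_near.
Qed.

Lemma cvg_rate_shift u J : (forall n, 0 <= u n) -> subadditive_seq u ->
  (fun n => u (n + J)%N / n%:R) @ \oo --> rate u.
Proof.
move=> u0 subu.
have cJ : (fun n => (u n + u J) / n%:R) @ \oo --> rate u.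
  rewrite -[rate u]addr0; under eq_fun do rewrite mulrDl.
  apply: cvgD; first exact: cvg_rate.
  rewrite -(mulr0 (u J)); apply: cvgM; first exact: cvg_cst.
  apply/gtr0_cvgV0; last exact: cvgr_idn.
  by exists 1%N => // n /= n0; rewrite ltr0n.
have cl : (fun n => u (n + J)%N / (n + J)%:R) @ \oo --> rate u.
  by rewrite (cvg_shiftn J (fun n => u n / n%:R)); exact: cvg_rate.
have cl2 : (fun n => rate u * (n + J)%:R / n%:R) @ \oo --> rate u.
  have e : (fun n => rate u + rate u * J%:R * n%:R^-1) @ \oo --> rate u.
    rewrite -[X in _ --> X]addr0; apply: cvgD; first exact: cvg_cst.
    rewrite -(mulr0 (rate u * J%:R)); apply: cvgM; first exact: cvg_cst.
    apply/gtr0_cvgV0; last exact: cvgr_idn.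
    by exists 1%N => // n /= n0; rewrite ltr0n.
  apply: cvg_trans e; apply: near_eq_cvg; exists 1%N => // n /= n0.
  have n0R : n%:R != 0 :> R by rewrite pnatr_eq0 -lt0n.
  by rewrite natrD; field.
apply: (squeeze_cvgr _ cl2 cJ); exists 1%N => // n /= n0.
rewrite !ler_pM2r ?invr_gt0 ?ltr0n// subu andbT rate_lbound//.
by rewrite addn_gt0 n0.
Qed.

(** A covering number at a fixed scale lies between the numbers of [n]-words and
    of [n + J]-words, where [J] depends on the scale only. *)
Lemma cvge_rate (u : nat -> R) (v : nat -> \bar R) J :
  (forall n, 0 <= u n) -> subadditive_seq u ->
  (forall n, ((u n)%:E <= v n)%E) ->
  (forall n, (v n <= (u (n + J)%N)%:E)%E) ->
  (fun n => (n%:R^-1)%:E * v n)%E @ \oo --> (rate u)%:E.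
Proof.
move=> u0 subu uv vu.
have c1 : (fun n => (u n / n%:R)%:E) @ \oo --> (rate u)%:E.
  by apply: cvg_EFin; [exact: nearW|exact: cvg_rate].
have c2 : (fun n => (u (n + J)%N / n%:R)%:E) @ \oo --> (rate u)%:E.
  by apply: cvg_EFin; [exact: nearW|exact: cvg_rate_shift].
apply: (squeeze_cvge _ c1 c2); apply: nearW => n.
rewrite ![_ / n%:R]mulrC !EFinM; apply/andP; split.
  by apply: lee_wpmul2l => //; rewrite lee_fin.
by apply: lee_wpmul2l => //; rewrite lee_fin.
Qed.

End Rate.

(** * Words of a subshift *)

Lemma iter_shift (E : Type) m (w : nat -> E) n :
  iter m shift_seq w n = w (m + n)%N.
Proof. by elim: m n => [//|m IH] n; rewrite iterS /shift_seq IH addnS. Qed.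

Definition word (E : finType) M (w : nat -> E) : {ffun 'I_M -> E} :=
  [ffun i : 'I_M => w i].

Lemma wordP (E : finType) M (w w' : nat -> E) :
  (forall n, (n < M)%N -> w n = w' n) <-> word M w = word M w'.
Proof.
split=> [ww'|/ffunP ww' n nM]; first by apply/ffunP => i; rewrite !ffunE ww'.
by have := ww' (Ordinal nM); rewrite !ffunE.
Qed.

Lemma word_add (E : finType) m n (w w' : nat -> E) :
  word m w = word m w' ->
  word n (iter m shift_seq w) = word n (iter m shift_seq w') ->
  word (m + n) w = word (m + n) w'.
Proof.
move=> /wordP e1 /wordP e2; apply/wordP => k kmn.
have [km|mk] := ltnP k m; first exact: e1.
have /e2 : (k - m < n)%N by rewrite ltn_subLR.
by rewrite !iter_shift subnKC.
Qed.

Lemma card_values_comp (Z Y : Type) (I : finType) (P : set Z) (Q : set Y)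
    (c : Y -> I) (f : Z -> Y) : (forall z, P z -> Q (f z)) ->
  (#|values P (c \o f)| <= #|values Q c|)%N.
Proof.
move=> PQ; apply/subset_leq_card/fintype.subsetP => i /valuesP[z Pz <-].
by apply: mem_values; apply: PQ.
Qed.

(** König's lemma, in the form of sequential compactness of [F^nat]. *)
Lemma konig (F : finType) (xi : nat -> nat -> F) :
  exists eta : nat -> F, forall N, exists2 K, (N <= K)%N &
    forall k, (k < N)%N -> xi K k = eta k.
Proof.
pose recurrent (s : seq F) := forall N, exists2 K, (N <= K)%N &
  forall k x0, (k < size s)%N -> xi K k = nth x0 s k.
have step s : recurrent s -> exists x, recurrent (rcons s x).
  move=> rs; apply: contrapT => /forallNP nx.
  have /choice[N HN] x : exists N, forall K, (N <= K)%N ->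
      exists k, (k <= size s)%N /\ exists x0, xi K k <> nth x0 (rcons s x) k.
    have /existsNP[N HN] := nx x; exists N => K NK.
    apply: contrapT => nk; apply: HN; exists K => // k x0.
    rewrite size_rcons ltnS => ks; apply: contrapT => ne.
    by apply: nk; exists k; split => //; exists x0.
  have [K NK sK] := rs (\max_x N x).
  have [k [ks [x0]]] := HN (xi K (size s)) K (leq_trans (leq_bigmax _) NK).
  rewrite nth_rcons; case: ltnP => [ks'|sk]; first by case; exact: sK.
  have -> : k = size s by apply/eqP; rewrite eqn_leq ks sk.
  by rewrite eqxx; case.
have /choice[ext extP] s : exists x, recurrent s -> recurrent (rcons s x).
  have [/step[x rx]|nr] := pselect (recurrent s); first by exists x.
  by exists (xi 0%N 0%N).
pose pre := fix pre n := if n is n'.+1 then rcons (pre n') (ext (pre n')) else [::].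
pose eta k := ext (pre k).
have preE n : pre n = mkseq eta n.
  by elim: n => [//|n IH]; rewrite mkseqS -IH.
have rpre n : recurrent (pre n).
  by elim: n => [N|n IH]; [exists N|exact: extP].
exists eta => N; have [K NK HK] := rpre N N; exists K => // k kN.
by rewrite (HK k (eta 0%N)) preE ?size_mkseq// nth_mkseq.
Qed.

(** Closedness in the product topology is used only through the approximation of
    a point by points that agree with it on longer and longer words. *)
Lemma subshift_limit (E : choiceType) (W : set (nat -> E)) (eta : nat -> E) :
  subshift W ->
  (forall N, exists2 w, W w & forall k, (k < N)%N -> w k = eta k) -> W eta.
Proof.
move=> [Wcl _] /(_ _)/cid2-/all_sig[w wP].
have WN N : W (w N) by case: (wP N).
have wE N k : (k < N)%N -> w N k = eta k by move=> kN; case: (wP N) => _; apply.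
apply: (@closed_cvg _ {ptws nat -> discrete_topology E} \oo _ w W Wcl).
  exact: nearW.
apply/cvg_sup => i A [_ [[C oC <-] /= Ceta] CA].
exists i.+1 => // N /= iN; apply: CA; rewrite /= /proj wE//.
Qed.

(** * Fibres and columns of the projection *)

Section LogCount.
Variable R : realType.
Implicit Types u f c : nat -> nat.

Definition log_count u (n : nat) : R := ln (u n)%:R.

Definition submultiplicative u := forall m n, (u (m + n) <= u m * u n)%N.

Lemma log_count_ge0 u n : (0 < u n)%N -> 0 <= log_count u n.
Proof. by move=> un; rewrite ln_ge0// ler1n. Qed.

Lemma log_count_le u f n : (0 < u n)%N -> (u n <= f n)%N ->
  log_count u n <= log_count f n.
Proof.
move=> u0 uf; rewrite /log_count ler_ln ?ler_nat// posrE ltr0n//.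
exact: leq_trans uf.
Qed.

Lemma subadditive_log u : (forall n, 0 < u n)%N -> submultiplicative u ->
  subadditive_seq (log_count u).
Proof.
move=> u0 um m n; rewrite /log_count -lnM ?posrE ?ltr0n// -natrM.
by rewrite ler_ln ?posrE ?ltr0n ?muln_gt0 ?u0// ler_nat.
Qed.

Lemma rate_log_le u f : (forall n, 0 < u n)%N -> (forall n, u n <= f n)%N ->
  rate (log_count u) <= rate (log_count f).
Proof.
move=> u0 uf; apply: lb_le_inf.
  by exists (log_count f 1 / 1%:R); exists 1%N.
move=> _ [n n0 <-]; rewrite ler_pdivlMr ?ltr0n//.
apply: le_trans (rate_lbound _ n0) (log_count_le (u0 n) (uf n)) => m.
by rewrite log_count_ge0.
Qed.

(** A block of length [n] costs only a factor [f n] as long as enough of the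
    word remains after it. Cutting off such blocks one after the other leaves a
    remainder of bounded length. *)
Lemma rate_log_eq f c :
  (forall n, 0 < f n)%N -> (forall n, f n <= c n)%N ->
  (forall n, exists K, forall M, (K <= n + M)%N -> (c (n + M) <= f n * c M)%N) ->
  rate (log_count c) = rate (log_count f).
Proof.
move=> f0 fc window; have c0 n : (0 < c n)%N by apply: leq_trans (fc n).
apply/le_anti/andP; split; last exact: rate_log_le.
apply: lb_le_inf; first by exists (log_count f 1 / 1%:R); exists 1%N.
move=> _ [n n0 <-]; rewrite ler_pdivlMr ?ltr0n//.
have [K HK] := window n.
have cq q : log_count c (q * n + K) <= q%:R * log_count f n + log_count c K.
  elim: q => [|q IH]; first by rewrite mul0r add0r.
  rewrite mulSn -addnA; apply: (@le_trans _ _ (log_count f n + log_count c (q * n + K))).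
    rewrite /log_count -lnM ?posrE ?ltr0n// -natrM.
    rewrite ler_ln ?posrE ?ltr0n ?muln_gt0 ?f0 ?c0// ler_nat; apply: HK.
    by rewrite addnA leq_addl.
  by rewrite -natr1 mulrDl mul1r; lra.
rewrite leNgt; apply/negP => lt.
set x := rate (log_count c) in lt *; set y := log_count f n in lt.
have xyq (q : nat) : (0 < q)%N -> q%:R * (x * n%:R - y) <= log_count c K.
  move=> q0; have qnK : (0 < q * n + K)%N by rewrite addn_gt0 muln_gt0 q0 n0.
  have := rate_lbound (u := log_count c) _ qnK.
  move=> /(_ (fun m => log_count_ge0 (c0 m))); rewrite -/x natrD natrM mulrDr => h1.
  have := cq q; rewrite -/y => h2.
  have h3 : 0 <= x * K%:R by rewrite mulr_ge0// rate_ge0// => m; exact: log_count_ge0.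
  lra.
have d0 : 0 < x * n%:R - y by rewrite subr_gt0.
have := xyq (Num.trunc (log_count c K / (x * n%:R - y))).+1 isT.
by rewrite -ler_pdivlMr// leNgt truncnS_gt.
Qed.

End LogCount.

Section Fibres.
Variables a b : nat.
Variable Omega : set (nat -> 'I_a * 'I_b).
Hypothesis hsub : subshift Omega.
Hypothesis hne : Omega !=set0.

Local Notation words M W := (values W (word M)).

Lemma subshift_iter (E : choiceType) (W : set (nat -> E)) m w :
  subshift W -> W w -> W (iter m shift_seq w).
Proof.
move=> [_ sW] Ww; elim: m => [//|m IH]; rewrite iterS.
by apply: sW; exists (iter m shift_seq w).
Qed.

Lemma proj2_iter m (w : nat -> 'I_a * 'I_b) :
  proj2 (iter m shift_seq w) = iter m shift_seq (proj2 w).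
Proof. by apply/funext => n; rewrite /proj2 !iter_shift. Qed.

Definition word_count (E : finType) (W : set (nat -> E)) M := #|words M W|.

Lemma word_count_submul (E : finType) (W : set (nat -> E)) :
  (forall m w, W w -> W (iter m shift_seq w)) ->
  submultiplicative (word_count W).
Proof.
move=> WS m n; rewrite /word_count.
apply: (@leq_trans (#|words m W| * #|values W (word n \o iter m shift_seq)|)).
  by apply: card_values_pair => w w' _ _; exact: word_add.
by rewrite leq_mul2l card_values_comp ?orbT// => w; exact: WS.
Qed.

Definition fibre (y : nat -> 'I_b) := Omega `&` proj2 @^-1` [set y].

Definition max_fibre M := \max_(S : {set {ffun 'I_M -> 'I_a * 'I_b}} |
  `[< exists2 w, Omega w & S = words M (fibre (proj2 w)) >]) #|S|.

Lemma le_max_fibre M w : Omega w ->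
  (#|words M (fibre (proj2 w))| <= max_fibre M)%N.
Proof.
move=> Ow; apply: (@leq_bigmax_cond _ _ (fun S : {set _} => #|S|)).
by apply/asboolP; exists w.
Qed.

Lemma max_fibre_attained M :
  exists2 w, Omega w & #|words M (fibre (proj2 w))| = max_fibre M.
Proof.
pose Q (S : {set {ffun 'I_M -> 'I_a * 'I_b}}) :=
  `[< exists2 w, Omega w & S = words M (fibre (proj2 w)) >].
have Q0 : (0 < #|Q|)%N.
  have [w Ow] := hne; apply/card_gt0P; exists (words M (fibre (proj2 w))).
  by apply/asboolP; exists w.
have [S + HS] := eq_bigmax_cond (fun S : {set _} => #|S|) Q0.
by move=> /asboolP[w Ow eS]; exists w => //; rewrite -eS -HS.
Qed.

Lemma max_fibre_gt0 M : (0 < max_fibre M)%N.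
Proof.
have [w Ow <-] := max_fibre_attained M.
by apply: card_values_gt0; exists w.
Qed.

Lemma max_fibre_submul : submultiplicative max_fibre.
Proof.
move=> m n; have [w Ow <-] := max_fibre_attained (m + n).
apply: (@leq_trans (#|words m (fibre (proj2 w))| *
    #|values (fibre (proj2 w)) (word n \o iter m shift_seq)|)).
  by apply: card_values_pair => z z' _ _; exact: word_add.
apply: leq_mul; first exact: le_max_fibre.
apply: leq_trans (le_max_fibre n (subshift_iter m hsub Ow)).
apply: card_values_comp => z [Oz /= zw]; split; first exact: subshift_iter.
by rewrite /= !proj2_iter zw.
Qed.

(** A ball fixes only a finite word of the projection, so upper bounds count the
    words over a word [v], of which there may be more than over any point [y]
    extending [v]. *)
Definition column M (v : {ffun 'I_M -> 'I_b}) :=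
  values [set w | Omega w /\ word M (proj2 w) = v] (word M).

Definition max_column M := \max_v #|@column M v|.

Lemma max_fibre_le_column M : (max_fibre M <= max_column M)%N.
Proof.
have [w Ow <-] := max_fibre_attained M.
apply: leq_trans (leq_bigmax (word M (proj2 w))).
by apply: card_values_subset => z [Oz /= zw]; split => //; rewrite zw.
Qed.

Lemma max_column_gt0 M : (0 < max_column M)%N.
Proof. exact: leq_trans (max_fibre_gt0 M) (max_fibre_le_column M). Qed.

Lemma word_count_le_column M :
  (word_count Omega M <= word_count (proj2 @` Omega) M * max_column M)%N.
Proof.
apply: (@leq_trans (#|values Omega (word M \o proj2)| * max_column M)).
  apply: card_values_fiber => w Ow.
  exact: (leq_bigmax (word M (proj2 w))).
by rewrite leq_mul2r card_values_comp ?orbT// => w Ow; exists w.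
Qed.

(** Compactness: over a long enough word of the projection there are no more
    possibilities for the first [n] letters than over a whole point. Otherwise
    there would be, for every [K], more than [max_fibre n] points of [Omega] with
    distinct initial [n]-words and a common projection up to [K], and a limit of
    these finite families would be a family in one fibre. *)
Lemma column_window n : exists K, forall w, Omega w ->
  (#|values [set z | Omega z /\ word K (proj2 z) = word K (proj2 w)] (word n)|
     <= max_fibre n)%N.
Proof.
apply: contrapT => /forallNP bad.
pose C K (w : nat -> 'I_a * 'I_b) := [set z | Omega z /\ word K (proj2 z) = word K (proj2 w)].
have /choice[w wP] K : exists w, Omega w /\
    (max_fibre n < #|values (C K w) (word n)|)%N.
  have /existsNP[w /not_implyP[Ow /negP]] := bad K.
  by rewrite -ltnNge; exists w.
have /choice[s sP] K : exists s : {ffun 'I_n -> 'I_a * 'I_b} -> nat -> 'I_a * 'I_b,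
    forall u, u \in values (C K (w K)) (word n) -> C K (w K) (s u) /\ word n (s u) = u.
  by apply: values_representatives; exists (w K); split => //; case: (wP K).
(* The finite set of words that occur is recorded next to the points, so that
   it stabilizes as well along the subsequence given by König's lemma. *)
pose xi K k := (values (C K (w K)) (word n), [ffun u => s K u k]).
have [eta etaP] := konig xi.
pose S := (eta 0%N).1; pose z u k := (eta k).2 u.
have agree N : exists K, [/\ (N <= K)%N, values (C K (w K)) (word n) = S &
    forall u k, (k < N)%N -> s K u k = z u k].
  have [K NK HK] := etaP N.+1; exists K; split; first exact: ltnW.
    by rewrite /S -(HK 0%N).
  by move=> u k kN; rewrite /z -HK ?ffunE// ltnW.
have Oz u : u \in S -> Omega (z u).
  move=> uS; apply: subshift_limit hsub _ => N.
  have [K [NK SK HK]] := agree N; exists (s K u); last by move=> k; exact: HK.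
  by have [|[]] := sP K u; rewrite ?SK.
have zn u : u \in S -> word n (z u) = u.
  move=> uS; have [K [NK SK HK]] := agree n.
  have [|_ {2}<-] := sP K u; first by rewrite SK.
  by apply/wordP => k kn; rewrite HK.
have zp u v : u \in S -> v \in S -> proj2 (z u) = proj2 (z v).
  move=> uS vS; apply/funext => k; have [K [NK SK HK]] := agree k.+1.
  have [|[_ /wordP pu] _] := sP K u; first by rewrite SK.
  have [|[_ /wordP pv] _] := sP K v; first by rewrite SK.
  by rewrite /proj2 -!HK// -/(proj2 (s K u) k) -/(proj2 (s K v) k) pu// pv.
have ltS : (max_fibre n < #|S|)%N.
  by have [K [_ <- _]] := agree 0%N; case: (wP K).
have [u0 u0S] : exists u, u \in S by apply/card_gt0P; apply: leq_ltn_trans ltS.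
have := le_max_fibre n (Oz _ u0S); rewrite leqNgt => /negP; apply.
apply: leq_trans ltS _; apply/subset_leq_card/fintype.subsetP => u uS.
apply/valuesP; exists (z u); last exact: zn.
by split; [exact: Oz|exact: zp].
Qed.

Lemma max_column_add_le m n k :
  (forall w, Omega w -> (#|values [set z | Omega z /\
     word (m + n) (proj2 z) = word (m + n) (proj2 w)] (word m)| <= k)%N) ->
  (max_column (m + n) <= k * max_column n)%N.
Proof.
move=> Hk; apply/bigmax_leqP => v _.
pose P := [set z | Omega z /\ word (m + n) (proj2 z) = v].
have [[w [Ow wv]]|no] := pselect (exists w, P w); last first.
  rewrite /column -/P; suff -> : values P (word (m + n)) = finset.set0.
    by rewrite cards0.
  apply/setP => u; rewrite finset.in_set0; apply/negbTE/negP.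
  by move=> /valuesP[w Pw _]; apply: no; exists w.
apply: (@leq_trans (#|values P (word m)| *
    #|values P (word n \o iter m shift_seq)|)).
  by apply: card_values_pair => z z' _ _; exact: word_add.
apply: leq_mul; first by rewrite /P -wv Hk.
apply: leq_trans (leq_bigmax (word n (iter m shift_seq (proj2 w)))).
apply: card_values_comp => z [Oz zv]; split; first exact: subshift_iter.
rewrite proj2_iter; apply/wordP => k' kn; rewrite !iter_shift.
by move: zv; rewrite -wv => /wordP; apply; rewrite ltn_add2l.
Qed.

Lemma max_column_submul : submultiplicative max_column.
Proof.
move=> m n; apply: max_column_add_le => w Ow.
apply: leq_trans (leq_bigmax (word m (proj2 w))).
apply: card_values_subset => z [Oz /wordP zw]; split => //.
by apply/wordP => k km; apply: zw; exact: ltn_addr.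
Qed.

(** In a long word of the projection, each block is followed by enough letters
    to count it by [max_fibre]. Hence columns and fibres have the same rate. *)
Lemma max_column_window n : exists K, forall M, (K <= n + M)%N ->
  (max_column (n + M) <= max_fibre n * max_column M)%N.
Proof.
have [K HK] := column_window n; exists K => M KM.
apply: max_column_add_le => w Ow; apply: leq_trans (HK w Ow).
apply: card_values_subset => z [Oz /wordP zw]; split => //.
by apply/wordP => k kK; apply: zw; exact: leq_trans KM.
Qed.

Lemma rate_max_column (R : realType) :
  rate (log_count R max_column) = rate (log_count R max_fibre).
Proof.
apply: rate_log_eq; [exact: max_fibre_gt0|exact: max_fibre_le_column|].
exact: max_column_window.
Qed.

End Fibres.

(** * Metrics that are weighted sums over coordinates *)

Section WeightedSum.
Variable R : realType.
Implicit Types g : nat -> R.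

Definition partial_wsum g (N : nat) : R := \sum_(n < N) 2^-1 ^+ n.+1 * g n.

Definition wsum g : R := limn (partial_wsum g).

Lemma partial_wsum_mono g : (forall n, 0 <= g n) ->
  {homo partial_wsum g : m n / (m <= n)%N >-> m <= n}.
Proof.
move=> g0; apply: homo_leq => [//|x y z|n]; first exact: le_trans.
by rewrite /partial_wsum big_ord_recr/= lerDl mulr_ge0// exprn_ge0// invr_ge0.
Qed.

Lemma half_exprn_gt0 n : 0 < 2^-1 ^+ n :> R.
Proof. by rewrite exprn_gt0// invr_gt0. Qed.

Lemma partial_wsum_le g c J N : (forall n, g n <= 1) -> 0 <= c ->
  (forall n, (n < J)%N -> g n <= c) ->
  partial_wsum g N <= c + (if (N <= J)%N then 0 else 2^-1 ^+ J).
Proof.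
move=> g1 c0 gc.
suff : partial_wsum g N <= c * (1 - 2^-1 ^+ N) +
    (if (N <= J)%N then 0 else 2^-1 ^+ J - 2^-1 ^+ N).
  move=> /le_trans; apply; have h := half_exprn_gt0 N.
  have : 0 <= c * 2^-1 ^+ N by rewrite mulr_ge0// ltW.
  by case: ifP => _; lra.
elim: N => [|N IH].
  by rewrite /partial_wsum big_ord0 expr0 subrr mulr0 leq0n addr0.
rewrite /partial_wsum big_ord_recr/= -/(partial_wsum g N).
have h := half_exprn_gt0 N.
have e : 2^-1 ^+ N.+1 = 2^-1 ^+ N / 2 :> R by rewrite exprSr.
have [NJ|JN] := ltnP N J.
  rewrite (ltnW NJ) in IH.
  have : 2^-1 ^+ N.+1 * g N <= 2^-1 ^+ N.+1 * c.
    by rewrite ler_wpM2l ?gc// ltW// half_exprn_gt0.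
  rewrite e; move: IH; set S := partial_wsum g N; set x := 2^-1 ^+ N.
  set y := x / 2 * g N; move=> h1 h2; nra.
have : 2^-1 ^+ N.+1 * g N <= 2^-1 ^+ N.+1 * 1.
  by rewrite ler_wpM2l ?gc// ltW// half_exprn_gt0.
have e2 : (if (N <= J)%N then 0 else 2^-1 ^+ J - 2^-1 ^+ N) =
    2^-1 ^+ J - 2^-1 ^+ N :> R.
  case: ifP => // NJ; have -> : N = J by apply/eqP; rewrite eqn_leq NJ JN.
  by rewrite subrr.
rewrite e2 in IH; rewrite e; move: IH; set S := partial_wsum g N.
set x := 2^-1 ^+ N in h *; set y := x / 2 * g N; set z := 2^-1 ^+ J.
move=> h1 h2; nra.
Qed.

Lemma cvg_wsum g : (forall n, 0 <= g n <= 1) ->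
  cvgn (partial_wsum g).
Proof.
move=> g01; apply: nondecreasing_is_cvgn.
  by apply: partial_wsum_mono => n; have /andP[] := g01 n.
exists 1 => _ [N _ <-]; have := @partial_wsum_le g 1 N N.
by rewrite leqnn addr0; apply => // n; have /andP[] := g01 n.
Qed.

Lemma wsum_le_tail g c J : (forall n, 0 <= g n <= 1) -> 0 <= c ->
  (forall n, (n < J)%N -> g n <= c) -> wsum g <= c + 2^-1 ^+ J.
Proof.
move=> g01 c0 gc; apply: limr_le; first exact: cvg_wsum.
apply: nearW => N; apply: le_trans (partial_wsum_le N _ c0 gc) _.
  by move=> n; have /andP[] := g01 n.
by rewrite lerD2l; case: ifP => // _; rewrite ltW// half_exprn_gt0.
Qed.

Lemma wsum_le g c : (forall n, 0 <= g n <= 1) -> 0 <= c ->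
  (forall n, g n <= c) -> wsum g <= c.
Proof.
move=> g01 c0 gc; apply: limr_le; first exact: cvg_wsum.
apply: nearW => N; have := @partial_wsum_le g c N N.
by rewrite leqnn addr0; apply => // n; have /andP[] := g01 n.
Qed.

(** The first coordinate has weight 1/2. *)
Lemma wsum_ge g : (forall n, 0 <= g n <= 1) -> g 0%N <= 2 * wsum g.
Proof.
move=> g01; have h : partial_wsum g 1 <= wsum g.
  apply: nondecreasing_cvgn_le; last exact: cvg_wsum.
  by apply: partial_wsum_mono => n; have /andP[] := g01 n.
by move: h; rewrite /partial_wsum big_ord1 expr1; lra.
Qed.

Lemma wsum_triangle g g1 g2 : (forall n, 0 <= g n <= 1) ->
  (forall n, 0 <= g1 n <= 1) -> (forall n, 0 <= g2 n <= 1) ->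
  (forall n, g n <= g1 n + g2 n) -> wsum g <= wsum g1 + wsum g2.
Proof.
move=> g01 g11 g21 gg; rewrite /wsum -limD; [|exact: cvg_wsum..].
apply: ler_lim; [exact: cvg_wsum|by apply: is_cvgD; exact: cvg_wsum|].
apply: nearW => N.
change (partial_wsum g N <= partial_wsum g1 N + partial_wsum g2 N).
rewrite /partial_wsum -big_split/=.
by apply: ler_sum => n _; rewrite -mulrDr ler_wpM2l// ltW// half_exprn_gt0.
Qed.

End WeightedSum.

(** The common form of the metrics on symbolic and carpet systems: the distance
    is a weighted sum of pseudo-distances [delta p q n] of the [n]-th coordinates,
    and the map shifts coordinates. *)
Record coordinate_metric (R : realType) (U : Type) (X : set U) (T : U -> U)
    (d : U -> U -> R) (delta : U -> U -> nat -> R) : Prop := CoordinateMetric {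
  coord_map : forall p, X p -> X (T p);
  coord_dist : forall p q, d p q = wsum (delta p q);
  coord_range : forall p q n, X p -> X q -> 0 <= delta p q n <= 1;
  coord_refl : forall p n, delta p p n = 0;
  coord_sym : forall p q n, delta p q n = delta q p n;
  coord_triangle : forall p q s n, delta p s n <= delta p q n + delta q s n;
  coord_shift : forall p q n, delta (T p) (T q) n = delta p q n.+1 }.

Section CoordinateMetric.
Variables (R : realType) (U : Type) (X : set U) (T : U -> U).
Variables (d : U -> U -> R) (delta : U -> U -> nat -> R).
Hypothesis cm : coordinate_metric X T d delta.
Local Notation dist M := (bowen_dist T d M).

Lemma coord_iter m p : X p -> X (iter m T p).
Proof. by move=> Xp; elim: m => [//|m IH]; rewrite iterS; exact: (coord_map cm). Qed.

Lemma coord_iter_shift m p q n :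
  delta (iter m T p) (iter m T q) n = delta p q (m + n)%N.
Proof.
by elim: m n => [//|m IH] n; rewrite !iterS (coord_shift cm) IH addnS addSn.
Qed.

Lemma bowen_dist_le M p q c : 0 <= c ->
  (forall m, (m < M)%N -> wsum (fun n => delta p q (m + n)%N) <= c) ->
  dist M p q <= c.
Proof.
move=> c0 h; apply/bigmax_leP; split => // m _.
rewrite (coord_dist cm).
rewrite (_ : delta _ _ = fun n => delta p q (m + n)%N) ?h//.
by apply/funext => n; rewrite coord_iter_shift.
Qed.

Lemma wsum_le_bowen_dist M p q m : (m < M)%N ->
  wsum (fun n => delta p q (m + n)%N) <= dist M p q.
Proof.
move=> mM; rewrite /bowen_dist.
have -> : wsum (fun n => delta p q (m + n)%N) = d (iter m T p) (iter m T q).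
  rewrite (coord_dist cm); congr wsum.
  by apply/funext => n; rewrite coord_iter_shift.
exact: (le_bigmax _ (fun m : 'I_M => d (iter m T p) (iter m T q)) (Ordinal mM)).
Qed.

Lemma bowen_dist_ge0 M p q : 0 <= dist M p q.
Proof. exact: bigmax_ge_id. Qed.

Lemma bowen_dist_le_tail M J p q c : X p -> X q -> 0 <= c ->
  (forall n, (n < M + J)%N -> delta p q n <= c) -> dist M p q <= c + 2^-1 ^+ J.
Proof.
move=> Xp Xq c0 h; apply: bowen_dist_le.
  by rewrite addr_ge0// ltW// half_exprn_gt0.
move=> m mM; apply: wsum_le_tail => // [n|n nJ]; first exact: (coord_range cm).
by apply: h; apply: leq_trans (_ : (m + n < m + J)%N) _; [rewrite ltn_add2l|
  rewrite leq_add2r ltnW].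
Qed.

Lemma bowen_dist_le_coord M p q c : X p -> X q -> 0 <= c ->
  (forall n, delta p q n <= c) -> dist M p q <= c.
Proof.
move=> Xp Xq c0 h; apply: bowen_dist_le => // m mM.
by apply: wsum_le => // n; exact: (coord_range cm).
Qed.

Lemma bowen_dist_le1 M p q : X p -> X q -> dist M p q <= 1.
Proof.
move=> Xp Xq; apply: bowen_dist_le_coord => // n.
by have /andP[] := coord_range cm n Xp Xq.
Qed.

Lemma coord_le_bowen_dist M p q n : X p -> X q -> (n < M)%N ->
  delta p q n <= 2 * dist M p q.
Proof.
move=> Xp Xq nM.
have := @wsum_ge R (fun k => delta p q (n + k)%N).
rewrite addn0 => /(_ (fun k => coord_range cm (n + k) Xp Xq)) /le_trans; apply.
by rewrite ler_wpM2l// wsum_le_bowen_dist.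
Qed.

Lemma bowen_dist_refl M p : X p -> dist M p p = 0.
Proof.
move=> Xp; apply/le_anti; rewrite bowen_dist_ge0 andbT.
by apply: bowen_dist_le_coord => // n; rewrite (coord_refl cm).
Qed.

Lemma bowen_dist_sym M p q : dist M p q = dist M q p.
Proof.
apply: eq_bigr => m _; rewrite !(coord_dist cm); congr wsum.
by apply/funext => n; rewrite (coord_sym cm).
Qed.

Lemma bowen_dist_triangle M p q s : X p -> X q -> X s ->
  dist M p s <= dist M p q + dist M q s.
Proof.
move=> Xp Xq Xs; apply: bowen_dist_le; first by rewrite addr_ge0// bowen_dist_ge0.
move=> m mM; apply: le_trans (lerD (wsum_le_bowen_dist p q mM) (wsum_le_bowen_dist q s mM)).
apply: wsum_triangle => n; [exact: (coord_range cm)..|].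
exact: (coord_triangle cm).
Qed.

Lemma bowen_dist_le_add M N p q : dist M p q <= dist (M + N)%N p q.
Proof.
apply/bigmax_leP; split => [|m _]; first exact: bowen_dist_ge0.
rewrite /bowen_dist.
exact: (le_bigmax _ (fun m : 'I_(M + N) => d (iter m T p) (iter m T q)) (lshift N m)).
Qed.

Lemma bowen_dist_iter_le M N p q :
  dist N (iter M T p) (iter M T q) <= dist (M + N)%N p q.
Proof.
apply/bigmax_leP; split => [|m _]; first exact: bowen_dist_ge0.
rewrite -!iterD ![(m + M)%N]addnC.
exact: (le_bigmax _ (fun m : 'I_(M + N) => d (iter m T p) (iter m T q)) (rshift M m)).
Qed.

End CoordinateMetric.

(** * Covering numbers *)

Section Covering.
Variables (R : realType) (U : Type) (X : set U) (D : U -> U -> R).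
Implicit Types (K : set U) (e : R) (n k : nat).

Lemma covering_number_le K e n : (0 < n)%N -> coverable X D K e n ->
  (covering_number X D K e <= n%:R%:E)%E.
Proof. by move=> n0 cn; apply: ereal_inf_lbound; exists n. Qed.

Lemma covering_number_ge K e (x : R) :
  (forall n, (0 < n)%N -> coverable X D K e n -> x <= n%:R) ->
  (x%:E <= covering_number X D K e)%E.
Proof.
by move=> h; apply/ereal_infP => _ [n [n0 cn] <-]; rewrite lee_fin h.
Qed.

Lemma covering_number_attained K e :
  (exists2 n, (0 < n)%N & coverable X D K e n) ->
  exists n, [/\ (0 < n)%N, coverable X D K e n &
    covering_number X D K e = n%:R%:E].
Proof.
move=> [m m0 cm]; pose P n := (0 < n)%N && `[< coverable X D K e n >].
have exP : exists n, P n by exists m; rewrite /P m0; apply/asboolP.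
case: (ex_minnP exP) => n /andP[n0 /asboolP cn] minn.
exists n; split=> //; apply/le_anti; rewrite covering_number_le//=.
apply: covering_number_ge => k k0 ck; rewrite ler_nat; apply: minn.
by rewrite /P k0; apply/asboolP.
Qed.

Lemma covering_number_ge1 K e : (1 <= covering_number X D K e)%E.
Proof. by apply: covering_number_ge => n n0 _; rewrite ler1n. Qed.

Lemma lne_covering_number_le K e n : (0 < n)%N -> coverable X D K e n ->
  (lne (covering_number X D K e) <= (ln n%:R)%:E)%E.
Proof.
move=> n0 cn; rewrite -lne_EFin ?ltr0n// lee_lne ?covering_number_le//.
  by rewrite in_itv/= leey andbT (le_trans _ (covering_number_ge1 _ _)).
by rewrite in_itv/= leey andbT lee_fin.
Qed.

Lemma lne_covering_number_ge K e (x : R) : 0 < x ->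
  (forall n, (0 < n)%N -> coverable X D K e n -> x <= n%:R) ->
  ((ln x)%:E <= lne (covering_number X D K e))%E.
Proof.
move=> x0 h; rewrite -lne_EFin// lee_lne ?covering_number_ge//.
  by rewrite in_itv/= leey andbT lee_fin ltW.
by rewrite in_itv/= leey andbT (le_trans _ (covering_number_ge1 _ _)).
Qed.

Lemma lne_covering_number_ge0 K e : (0 <= lne (covering_number X D K e))%E.
Proof. by rewrite lne_ge0 covering_number_ge1. Qed.

End Covering.

Section CoveringCodes.
Variables (R : realType) (U : Type) (X : set U) (T : U -> U).
Variables (d : U -> U -> R) (delta : U -> U -> nat -> R).
Hypothesis cm : coordinate_metric X T d delta.
Variables (Z : Type) (I : finType) (P : set Z) (pt : Z -> U) (c : Z -> I).
Local Notation dist M := (bowen_dist T d M).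

(** Sets of points with a common code need not be open, so they are replaced by
    their open neighbourhoods of radius [e / 3], which is why the diameter of
    such a set has to be at most [e / 3]. *)
Lemma coverable_of_codes M K e n : 0 < e ->
  (forall z, P z -> X (pt z)) ->
  (forall p, K p -> exists2 z, P z & pt z = p) ->
  (forall z z', P z -> P z' -> c z = c z' -> dist M (pt z) (pt z') <= e / 3) ->
  (#|values P c| <= n)%N -> coverable X (dist M) K e n.
Proof.
move=> e0 PX KP small cn.
have e3 : 0 < e / 3 by rewrite divr_gt0.
pose S := values P c.
(* The members of the cover are numbered by the position of a code in [enum S];
   positions beyond the end of the list give the empty set. *)
exists (fun j : 'I_n => [set q | X q /\ exists2 z, P z &
   index (c z) (enum S) = j /\ dist M (pt z) q < e / 3]).
split=> [j|p Kp].
  split; first split=> [q []//|q [Xq [z Pz [cz zq]]]].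
    exists (e / 3 - dist M (pt z) q); first by rewrite subr_gt0.
    move=> q' Xq' qq'; split=> //; exists z => //; split=> //.
    have := bowen_dist_triangle cm M (PX _ Pz) Xq Xq'; lra.
  move=> q q' [Xq [z Pz [cz zq]]] [Xq' [z' Pz' [cz' zq']]].
  have czz' : c z = c z'.
    apply: (@index_inj _ (c z) (enum S)); rewrite ?mem_enum ?mem_values//.
    by rewrite cz cz'.
  have h1 := bowen_dist_triangle cm M Xq (PX _ Pz) Xq'.
  have h2 := bowen_dist_triangle cm M (PX _ Pz) (PX _ Pz') Xq'.
  have h3 := small _ _ Pz Pz' czz'.
  move: h1; rewrite [dist M q (pt z)](bowen_dist_sym cm); lra.
have [z Pz zp] := KP _ Kp.
have jn : (index (c z) (enum S) < n)%N.
  by apply: leq_trans cn; rewrite cardE index_mem mem_enum mem_values.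
exists (Ordinal jn) => //; rewrite -zp; split; first exact: PX.
by exists z => //; split => //; rewrite (bowen_dist_refl cm)//; exact: PX.
Qed.

(** A member of the cover that contains [pt z0] lies in the ball of radius [e]
    around it, so it can meet only few codes. *)
Lemma codes_le_coverable M K e n k :
  (forall z, P z -> K (pt z)) ->
  (forall z0, P z0 ->
    (#|values [set z | P z /\ (dist M (pt z0) (pt z) <= e)%R] c| <= k)%N) ->
  coverable X (dist M) K e n -> (#|values P c| <= k * n)%N.
Proof.
move=> PK near [V [VP KV]].
apply: (@leq_trans #|\bigcup_(i < n) values [set z | P z /\ V i (pt z)] c|%SET).
  apply/subset_leq_card/fintype.subsetP => _ /valuesP[z Pz <-].
  have [i _ Viz] := KV _ (PK _ Pz); apply/bigcupP; exists i => //.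
  by apply/valuesP; exists z.
apply: (@leq_trans (\sum_(i < n) k)%N); last first.
  by rewrite sum_nat_const card_ord mulnC.
elim/big_rec2: _ => [|i m A _ Am]; first by rewrite cards0.
apply: leq_trans (leq_card_setU _ _) _; rewrite leq_add//.
have [[z0 [Pz0 Vz0]]|no] := pselect (exists z0, P z0 /\ V i (pt z0)).
  apply: leq_trans (near _ Pz0); apply: card_values_subset => z [Pz Vz].
  by split => //; apply: (VP i).2.
suff -> : values [set z | P z /\ V i (pt z)] c = finset.set0 by rewrite cards0.
apply/setP => j; rewrite finset.in_set0; apply/negbTE/negP => /valuesP[z Pz _].
by apply: no; exists z.
Qed.

End CoveringCodes.

(** * Existence of the growth rate of covering numbers of balls *)

Section LocalGrowth.
Variables (R : realType) (U : Type) (X : set U) (T : U -> U).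
Variables (d : U -> U -> R) (delta : U -> U -> nat -> R).
Hypothesis cm : coordinate_metric X T d delta.
Hypothesis X0 : X !=set0.
Local Notation dist M := (bowen_dist T d M).

(** A cover for the first [M] steps and a cover for the next [N] steps have a
    common refinement by the sets [V1 `&` iter M T @^-1` V2]. *)
Lemma coverable_add M N K K1 K2 e n1 n2 :
  K `<=` X -> K `<=` K1 -> (forall p, K p -> K2 (iter M T p)) ->
  coverable X (dist M) K1 e n1 -> coverable X (dist N) K2 e n2 ->
  coverable X (dist (M + N)) K e (n1 * n2).
Proof.
move=> KX KK1 KK2 [V1 [V1P KV1]] [V2 [V2P KV2]].
pose W (i : 'I_n1 * 'I_n2) := V1 i.1 `&` (X `&` iter M T @^-1` V2 i.2).
have WP i : open_in X (dist (M + N)) (W i) /\ diam_le (dist (M + N)) (W i) e.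
  have [[V1X V1o] V1d] := V1P i.1; have [[V2X V2o] V2d] := V2P i.2.
  split; first split=> [p [/V1X]//|p [V1p [Xp V2p]]].
    have [e1 e10 h1] := V1o _ V1p; have [e2 e20 h2] := V2o _ V2p.
    exists (Num.min e1 e2); first by rewrite lt_min e10.
    move=> q Xq; rewrite lt_min => /andP[pq1 pq2]; split; last split => //.
      apply: h1 => //; apply: le_lt_trans pq1; exact: bowen_dist_le_add.
    apply: h2; first exact: (coord_iter cm).
    apply: le_lt_trans pq2; exact: bowen_dist_iter_le.
  move=> p q [V1p [Xp V2p]] [V1q [Xq V2q]].
  apply/bigmax_leP; split=> [|m _].
    exact: le_trans (bowen_dist_ge0 T d M p q) (V1d _ _ V1p V1q).
  have [mM|Mm] := ltnP m M.
    apply: le_trans (V1d _ _ V1p V1q); rewrite /bowen_dist.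
    exact: (le_bigmax _ (fun m : 'I_M => d (iter m T p) (iter m T q)) (Ordinal mM)).
  have mMN : (m - M < N)%N by rewrite ltn_subLR.
  apply: le_trans (V2d _ _ V2p V2q); rewrite /bowen_dist.
  have := le_bigmax 0 (fun k : 'I_N => d (iter k T (iter M T p))
    (iter k T (iter M T q))) (Ordinal mMN).
  by rewrite /= -!iterD subnK.
have cardE : #|{: 'I_n1 * 'I_n2}| = (n1 * n2)%N by rewrite card_prod !card_ord.
pose val (j : 'I_(n1 * n2)) := enum_val (cast_ord (esym cardE) j).
exists (W \o val); split=> [j|p Kp]; first exact: WP.
have [i1 _ h1] := KV1 _ (KK1 _ Kp); have [i2 _ h2] := KV2 _ (KK2 _ Kp).
exists (cast_ord cardE (enum_rank (i1, i2))) => //=.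
rewrite /val cast_ordK enum_rankK; split => //; split => //; exact: KX.
Qed.

Variables (r rho : R).
Hypothesis finite_cover : forall M, exists2 n, (0 < n)%N & forall x, X x ->
  coverable X (dist M) (cball_in X (dist M) x r) rho n.

(** The image of a [d_(M + N)]-ball under [iter M T] lies in a [d_N]-ball of the
    same radius, so the supremum over all centres is submultiplicative. *)
Lemma local_growth_subadditive : exists u : nat -> R,
  [/\ forall M, ereal_sup [set log_cover X T d M (cball_in X (dist M) x r) rho
        | x in X] = (u M)%:E,
      forall M, 0 <= u M & subadditive_seq u].
Proof.
pose s M := ereal_sup [set log_cover X T d M (cball_in X (dist M) x r) rho
  | x in X].
have s_fin M : (0 <= s M)%E /\ s M \is a fin_num.
  have s0 : (0 <= s M)%E.
    have [x Xx] := X0; apply: (@le_trans _ _ (log_cover X T d M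
      (cball_in X (dist M) x r) rho)); first exact: lne_covering_number_ge0.
    by apply: ereal_sup_ubound; exists x.
  split => //; have [n n0 cn] := finite_cover M.
  rewrite ge0_fin_numE//.
  apply: (@le_lt_trans _ _ (ln n%:R)%:E); last exact: ltey.
  apply/ereal_supP => _ [x Xx <-].
  by apply: lne_covering_number_le => //; exact: cn.
exists (fun M => fine (s M)); split=> [M|M|M N].
- by rewrite fineK//; case: (s_fin M).
- by apply: fine_ge0; case: (s_fin M).
have sE M' : s M' = (fine (s M'))%:E by rewrite fineK//; case: (s_fin M').
rewrite -lee_fin EFinD -!sE; apply/ereal_supP => _ [x Xx <-].
have XTx : X (iter M T x) by exact: (coord_iter cm).
have [n1 [n10 cn1 E1]] : exists n, [/\ (0 < n)%N,
    coverable X (dist M) (cball_in X (dist M) x r) rho n &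
    covering_number X (dist M) (cball_in X (dist M) x r) rho = n%:R%:E].
  apply: covering_number_attained; have [n n0 cn] := finite_cover M.
  by exists n => //; exact: cn.
have [n2 [n20 cn2 E2]] : exists n, [/\ (0 < n)%N,
    coverable X (dist N) (cball_in X (dist N) (iter M T x) r) rho n &
    covering_number X (dist N) (cball_in X (dist N) (iter M T x) r) rho = n%:R%:E].
  apply: covering_number_attained; have [n n0 cn] := finite_cover N.
  by exists n => //; exact: cn.
apply: (@le_trans _ _ ((ln n1%:R)%:E + (ln n2%:R)%:E)%E); last first.
  apply: leeD; rewrite -lne_EFin ?ltr0n//.
    by rewrite -E1; apply: ereal_sup_ubound; exists x.
  by rewrite -E2; apply: ereal_sup_ubound; exists (iter M T x).
rewrite -EFinD -lnM ?posrE ?ltr0n// -natrM.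
apply: lne_covering_number_le; first by rewrite muln_gt0 n10.
apply: coverable_add cn1 cn2 => [p []//|p [Xp h]|p [Xp h]]; split => //.
- exact: le_trans (bowen_dist_le_add _ _ _ _ _ _) h.
- exact: (coord_iter cm).
- exact: le_trans (bowen_dist_iter_le _ _ _ _ _ _) h.
Qed.

End LocalGrowth.

(** * Entropies of symbolic systems *)

Section Symbolic.
Variables (R : realType) (E : finType) (W : set (nat -> E)).
Hypothesis W_shift : forall w, W w -> W (shift_seq w).
Local Notation dist M := (bowen_dist shift_seq (symb_dist R) M).

Definition symb_delta (w w' : nat -> E) n : R := (w n != w' n)%:R.

Lemma symb_coordinate_metric :
  coordinate_metric W shift_seq (symb_dist R) symb_delta.
Proof.
split => //.
- by move=> w w' n _ _; rewrite /symb_delta ler0n lern1 leq_b1.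
- by move=> w n; rewrite /symb_delta eqxx.
- by move=> w w' n; rewrite /symb_delta eq_sym.
move=> w w' w'' n; rewrite /symb_delta; case: (eqVneq (w n) (w' n)) => [->|_].
  by rewrite add0r.
by apply: (@le_trans _ _ 1); [rewrite lern1 leq_b1|rewrite lerDl].
Qed.

Local Notation cm := symb_coordinate_metric.

Lemma near_half (P : R -> Prop) :
  (forall e, 0 < e -> e < 2^-1 -> P e) -> \forall e \near 0^'+, P e.
Proof.
move=> h; near=> e; apply: h; first by near: e; exact: nbhs_right_gt.
by near: e; apply: nbhs_right_lt; rewrite invr_gt0.
Unshelve. all: by end_near.
Qed.

Lemma half_exprn_le (e : R) : 0 < e -> exists J, 2^-1 ^+ J <= e.
Proof.
move=> e0; have h : \forall J \near \oo, (2^-1 : R) ^+ J < e.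
  have : (fun J => (2^-1 : R) ^+ J) @ \oo --> 0.
    apply: cvg_expr; rewrite ger0_norm ?invr_ge0// invf_lt1//.
    by rewrite ltr1n.
  move=> /cvgrPdist_lt /(_ e e0); apply: filterS => J; rewrite sub0r normrN.
  by rewrite ger0_norm// ltW// half_exprn_gt0.
by have [J /ltW] := filter_ex h; exists J.
Qed.

(** Points at distance less than 1/2 have the same first letter, so below that
    scale a set of small diameter contains a single [M]-word. *)
Lemma log_cover_symb_ge M (K : set (nat -> E)) e : K `<=` W -> K !=set0 ->
  e < 2^-1 ->
  ((ln #|values K (word M)|%:R)%:E
     <= log_cover W shift_seq (symb_dist R) M K e)%E.
Proof.
move=> KW K0 e2; apply: lne_covering_number_ge.
  by rewrite ltr0n card_values_gt0.
move=> n _ cn; rewrite ler_nat -[n]mul1n.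
apply: (codes_le_coverable (pt := id) _ _ cn) => // w Kw.
suff h z : K z -> dist M w z <= e -> word M w = word M z.
  apply: card_values_le1 => z z' [Kz /= dz] [Kz' dz'].
  by rewrite -(h _ Kz dz) -(h _ Kz' dz').
move=> Kz dz; apply/wordP => k kM.
have := coord_le_bowen_dist cm (KW _ Kw) (KW _ Kz) kM.
rewrite /symb_delta; case: (w k =P z k) => //= _ h.
by exfalso; move: h e2 dz; clear; lra.
Qed.

Lemma log_cover_symb_le M J (K : set (nat -> E)) e : K `<=` W -> K !=set0 ->
  0 < e -> 2^-1 ^+ J <= e / 3 ->
  (log_cover W shift_seq (symb_dist R) M K e
     <= (ln #|values K (word (M + J))|%:R)%:E)%E.
Proof.
move=> KW K0 e0 Je; apply: lne_covering_number_le; first exact: card_values_gt0.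
apply: (coverable_of_codes cm (P := K) (pt := id) (c := word (M + J))) => //.
  by move=> p Kp; exists p.
move=> z z' Kz Kz' /wordP zz'; apply: le_trans Je; rewrite -[leRHS]add0r.
apply: (bowen_dist_le_tail cm) => //; [exact: KW..|].
by move=> n nM; rewrite /symb_delta zz' ?eqxx.
Qed.

Hypothesis W0 : W !=set0.

Lemma htop_symb : htop W shift_seq (symb_dist R) =
  (rate (log_count R (word_count W)))%:E.
Proof.
have W_iter m w : W w -> W (iter m shift_seq w).
  by move=> Ww; elim: m => [//|m IH]; rewrite iterS; apply: W_shift.
have wc0 n : (0 < word_count W n)%N by apply: card_values_gt0.
apply: lim_near_cst; first exact: ereal_hausdorff.
apply: near_half => e e0 e2.
have [J HJ] := half_exprn_le (divr_gt0 e0 (ltr0n R 3)).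
apply/cvg_lim => //; apply: (cvge_rate (J := J)) => [n|||].
- exact: log_count_ge0.
- by apply: subadditive_log => //; exact: word_count_submul.
- by move=> M; exact: log_cover_symb_ge.
- by move=> M; apply: log_cover_symb_le => //; exact: HJ.
Qed.

End Symbolic.

Lemma htop_cond_symb (R : realType) (a b : nat)
    (Omega : set (nat -> 'I_a * 'I_b)) : subshift Omega -> Omega !=set0 ->
  htop_cond Omega shift_seq (symb_dist R) (proj2 @` Omega) proj2 =
  (rate (log_count R (max_fibre Omega)))%:E.
Proof.
move=> hsub hne.
have W_shift w : Omega w -> Omega (shift_seq w).
  by move=> Ow; apply: hsub.2; exists w.
apply: lim_near_cst; first exact: ereal_hausdorff.
apply: near_half => e e0 e2.
have [J HJ] := half_exprn_le (divr_gt0 e0 (ltr0n R 3)).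
apply/cvg_lim => //; apply: (cvge_rate (J := J)) => [n|||].
- by apply: log_count_ge0; exact: max_fibre_gt0.
- apply: subadditive_log => [n|]; first exact: max_fibre_gt0.
  exact: max_fibre_submul.
- move=> M; have [w Ow wM] := max_fibre_attained hne M.
  rewrite /log_count -wM; apply: le_ereal_sup_tmp.
  exists (log_cover Omega shift_seq (symb_dist R) M (fibre Omega (proj2 w)) e).
    by exists (proj2 w) => //; exists w.
  apply: log_cover_symb_ge => //; first by move=> z [].
  by exists w.
move=> M; apply/ereal_supP => _ [_ [w Ow <-] <-].
have w0 : fibre Omega (proj2 w) !=set0 by exists w.
apply: le_trans (log_cover_symb_le W_shift _ _ w0 e0 HJ) _; first by move=> z [].
rewrite lee_fin /log_count ler_ln ?ler_nat; first exact: le_max_fibre.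
  by rewrite posrE ltr0n card_values_gt0.
by rewrite posrE ltr0n max_fibre_gt0.
Qed.

(** * Digit expansions *)

Section Digits.
Variables (R : realType) (c : nat).
Hypothesis c1 : (1 < c)%N.
Implicit Types (d : nat -> 'I_c) (l : nat).

Definition partial_expansion d l : R := \sum_(m < l) (d m)%:R / c%:R ^+ m.+1.

Definition expansion d : R := limn (partial_expansion d).

(** The integer with base-[c] digits [d 0, ..., d (l - 1)]. *)
Fixpoint leading_value d l : nat :=
  if l is l'.+1 then (c * leading_value d l' + d l')%N else 0%N.

Let cR0 : 0 < c%:R :> R. Proof. by rewrite ltr0n ltnW. Qed.
Let cX0 l : 0 < c%:R ^+ l :> R. Proof. exact: exprn_gt0. Qed.

Lemma partial_expansionE d l :
  partial_expansion d l = (leading_value d l)%:R / c%:R ^+ l.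
Proof.
elim: l => [|l IH]; first by rewrite /partial_expansion big_ord0 mul0r.
rewrite /partial_expansion big_ord_recr/= -/(partial_expansion d l) IH.
rewrite natrD natrM exprS; have := cX0 l; have := cR0.
move=> /lt0r_neq0 h1 /lt0r_neq0 h2; field.
by rewrite h1 h2.
Qed.

Lemma partial_expansion_mono d :
  {homo partial_expansion d : m n / (m <= n)%N >-> m <= n}.
Proof.
apply: homo_leq => [//|x y z|n]; first exact: le_trans.
by rewrite /partial_expansion big_ord_recr/= lerDl divr_ge0.
Qed.

Lemma partial_expansion_tail d l k :
  partial_expansion d (l + k) + (c%:R ^+ (l + k))^-1
    <= partial_expansion d l + (c%:R ^+ l)^-1.
Proof.
elim: k => [|k]; first by rewrite addn0.
apply: le_trans; rewrite addnS /partial_expansion big_ord_recr/= -addrA lerD2l.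
rewrite -[X in _ + X]mul1r -mulrDl natr1 ler_pdivrMr//.
rewrite exprS mulrCA mulVf ?mulr1 ?ler_nat//.
by rewrite lt0r_neq0.
Qed.

Lemma partial_expansion_le d l N :
  partial_expansion d N <= partial_expansion d l + (c%:R ^+ l)^-1.
Proof.
have [Nl|lN] := leqP N l.
  apply: le_trans (partial_expansion_mono _ Nl) _.
  by rewrite lerDl invr_ge0 ltW.
have := partial_expansion_tail d l (N - l); rewrite subnKC ?(ltnW lN)//.
by apply: le_trans; rewrite lerDl invr_ge0 ltW.
Qed.

Lemma cvg_expansion d : cvgn (partial_expansion d).
Proof.
apply: nondecreasing_is_cvgn; first exact: partial_expansion_mono.
by exists (partial_expansion d 0 + (c%:R ^+ 0)^-1) => _ [N _ <-];
  exact: partial_expansion_le.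
Qed.

Lemma expansion_ge d l : partial_expansion d l <= expansion d.
Proof.
exact: nondecreasing_cvgn_le (@partial_expansion_mono d) (@cvg_expansion d) l.
Qed.

Lemma expansion_le d l : expansion d <= partial_expansion d l + (c%:R ^+ l)^-1.
Proof.
apply: limr_le; first exact: cvg_expansion.
by apply: nearW => N; exact: partial_expansion_le.
Qed.

Lemma expansion_itv d : 0 <= expansion d <= 1.
Proof.
have := expansion_ge d 0; have := expansion_le d 0.
by rewrite /partial_expansion big_ord0 expr0 invr1 add0r => -> ->.
Qed.

Lemma leading_value_inj d d' l : leading_value d l = leading_value d' l ->
  forall m, (m < l)%N -> d m = d' m.
Proof.
elim: l => [//|l IH] /= e m.
have dl : d l = d' l.
  apply: val_inj; have := congr1 (modn^~ c) e.
  by rewrite /= ![(c * _)%N]mulnC !modnMDl !modn_small.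
have /IH h : leading_value d l = leading_value d' l.
  move: e; rewrite dl => /addIn/eqP; rewrite eqn_mul2l => /orP[|/eqP//].
  by rewrite gtn_eqF// ltnW.
by rewrite ltnS leq_eqVlt => /predU1P[->//|/h].
Qed.

Lemma eq_leading_value d d' l : (forall m, (m < l)%N -> d m = d' m) ->
  leading_value d l = leading_value d' l.
Proof.
by elim: l => [//|l IH] h /=; rewrite h// IH// => m ml; rewrite h// ltnW.
Qed.

Lemma expansion_close d d' l : (forall m, (m < l)%N -> d m = d' m) ->
  `|expansion d - expansion d'| <= (c%:R ^+ l)^-1.
Proof.
move=> h.
have e : partial_expansion d l = partial_expansion d' l.
  by rewrite !partial_expansionE (eq_leading_value h).
have := expansion_ge d l; have := expansion_le d l.
have := expansion_ge d' l; have := expansion_le d' l.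
by rewrite e ler_distl; lra.
Qed.

(** An expansion times [c ^ l] lies in the interval of length 1 starting at the
    leading value. *)
Lemma leading_value_close d d' l :
  `|expansion d - expansion d'| <= 2 / c%:R ^+ l ->
  (leading_value d l <= leading_value d' l + 3)%N.
Proof.
rewrite ler_distl => /andP[_ h].
have := expansion_ge d l; have := expansion_le d' l.
rewrite !partial_expansionE => h1 h2.
have : (leading_value d l)%:R / c%:R ^+ l <=
    ((leading_value d' l)%:R + 3) / c%:R ^+ l :> R.
  by rewrite mulrDl; move: h h1 h2; lra.
by rewrite ler_pM2r ?invr_gt0// -natrD ler_nat.
Qed.

End Digits.

(** * Carpets as spaces of coded points *)

Section Carpet.
Variables (R : realType) (a b : nat).
Hypotheses (a1 : (1 < a)%N) (b1 : (1 < b)%N).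
Variable Omega : set (nat -> 'I_a * 'I_b).
Implicit Types (z : nat -> nat -> 'I_a * 'I_b) (w : nat -> 'I_a * 'I_b).

Local Notation X := (carpet R Omega).
Local Notation dist M := (bowen_dist (@shift_pair R) carpet_dist M).

Definition coded_point z : (nat -> R) * (nat -> R) :=
  (fun n => expansion R (fun m => (z m n).1),
   fun n => expansion R (fun m => (z m n).2)).

Lemma uniform_expansion (c : nat) (d : nat -> nat -> 'I_c) (x : nat -> R) :
  (1 < c)%N ->
  {uniform, (fun N n => partial_expansion R (d^~ n) N) @ \oo --> x} <->
  x = fun n => expansion R (d^~ n).
Proof.
move=> c1; split=> [cx|->].
  apply/funext => n.
  have /(uniform_subset_cvg (B := [set n])) := cx.
  rewrite uniform_set1 => /(_ (@subsetT _ _))/cvg_lim <- //.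
move=> A /uniform_nbhs[E [entE EA]].
move: entE; rewrite -entourage_ballE => -[e /= e0 eE].
have : \forall l \near \oo, (c%:R ^+ l : R)^-1 < e.
  have : (fun l => (c%:R^-1 : R) ^+ l) @ \oo --> 0.
    apply: cvg_expr; rewrite ger0_norm ?invr_ge0// invf_lt1//.
      by rewrite ltr1n.
    by rewrite ltr0n ltnW.
  move=> /cvgrPdist_lt /(_ e e0); apply: filterS => l; rewrite sub0r normrN.
  by rewrite ger0_norm ?exprn_ge0 ?invr_ge0// exprVn.
apply: filterS => l le; apply: EA => n _; apply: eE => /=.
rewrite /ball/= ltr_distl.
have h1 := expansion_ge R c1 (d^~ n) l; have h2 := expansion_le R c1 (d^~ n) l.
by move: h1 h2 le; lra.
Qed.

Lemma carpetP p : X p <-> exists2 z, forall m, Omega (z m) & coded_point z = p.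
Proof.
case: p => x y; split=> [[z [Oz xz yz]]|[z Oz [<- <-]]].
  exists z => //; congr pair.
    by apply/esym/(uniform_expansion (fun m n => (z m n).1) _ a1).
  by apply/esym/(uniform_expansion (fun m n => (z m n).2) _ b1).
exists z; split=> //.
  exact/(uniform_expansion (fun m n => (z m n).1) _ a1).
exact/(uniform_expansion (fun m n => (z m n).2) _ b1).
Qed.

Lemma coded_point_carpet z : (forall m, Omega (z m)) -> X (coded_point z).
Proof. by move=> Oz; apply/carpetP; exists z. Qed.

Definition carpet_delta (p q : (nat -> R) * (nat -> R)) n : R :=
  Num.max `|p.1 n - q.1 n| `|p.2 n - q.2 n|.

Lemma carpet_coordinate_metric : (forall w, Omega w -> Omega (shift_seq w)) ->
  coordinate_metric X shift_pair carpet_dist carpet_delta.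
Proof.
move=> O_shift; split => //.
- move=> p /carpetP[z Oz <-]; apply/carpetP.
  by exists (fun m => shift_seq (z m)) => // m; exact: O_shift.
- move=> p q n /carpetP[z Oz <-] /carpetP[z' Oz' <-].
  have H (c : nat) (d d' : nat -> 'I_c) : (1 < c)%N ->
      `|expansion R d - expansion R d'| <= 1.
    move=> c1; have := expansion_itv R c1 d; have := expansion_itv R c1 d'.
    by rewrite ler_distl; lra.
  by rewrite /carpet_delta le_max normr_ge0/= ge_max !H.
- by move=> p n; rewrite /carpet_delta !subrr normr0 maxxx.
- by move=> p q n; rewrite /carpet_delta distrC [X in Num.max _ X]distrC.
- move=> p q s n; rewrite /carpet_delta ge_max; apply/andP; split.
    by apply: le_trans (ler_distD (q.1 n) _ _) _; rewrite lerD// le_max lexx.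
  by apply: le_trans (ler_distD (q.2 n) _ _) _; rewrite lerD// le_max lexx orbT.
Qed.

(** The part of a symbol that is visible at a given scale. Since [b < a], more
    digits are needed in base [b] than in base [a], and at the last levels only
    the second coordinate can be seen. *)
Definition visible (v : bool) (s : 'I_a * 'I_b) : option 'I_a * 'I_b :=
  (if v then Some s.1 else None, s.2).

Definition layer v M w : {ffun 'I_M -> option 'I_a * 'I_b} :=
  [ffun n : 'I_M => visible v (w n)].

Definition code l1 l2 M z : {ffun 'I_l2 -> {ffun 'I_M -> option 'I_a * 'I_b}} :=
  [ffun m : 'I_l2 => layer (m < l1)%N M (z m)].

Lemma layer_true M w w' : layer true M w = layer true M w' <-> word M w = word M w'.
Proof.
split=> [/ffunP h|/wordP h]; last by apply/ffunP => n; rewrite !ffunE h.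
apply/wordP => n nM; have := h (Ordinal nM); rewrite !ffunE /visible /=.
by move=> [] e1 e2; apply: injective_projections.
Qed.

Lemma layer_false M w w' :
  layer false M w = layer false M w' <-> word M (proj2 w) = word M (proj2 w').
Proof.
split=> [/ffunP h|/wordP h].
  by apply/wordP => n nM; have := h (Ordinal nM); rewrite !ffunE => -[].
apply/ffunP => n; rewrite !ffunE /visible; congr pair.
exact: (h n (ltn_ord n)).
Qed.

Lemma layer_le (v v' : bool) M w w' : (v' -> v) -> layer v M w = layer v M w' ->
  layer v' M w = layer v' M w'.
Proof.
case: v v' => [[//|_]|[/(_ isT)//|//]] /layer_true/wordP h.
by apply/layer_false/wordP => n nM; rewrite /proj2 h.
Qed.

Lemma codeP l1 l2 M z z' : code l1 l2 M z = code l1 l2 M z' <->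
  forall m, (m < l2)%N -> layer (m < l1)%N M (z m) = layer (m < l1)%N M (z' m).
Proof.
split=> [/ffunP h m ml|h]; last by apply/ffunP => m; rewrite !ffunE h.
by have := h (Ordinal ml); rewrite !ffunE.
Qed.

Lemma code_digits l1 l2 M z z' : (l1 <= l2)%N -> code l1 l2 M z = code l1 l2 M z' <->
  forall n, (n < M)%N -> (forall m, (m < l1)%N -> (z m n).1 = (z' m n).1) /\
                         (forall m, (m < l2)%N -> (z m n).2 = (z' m n).2).
Proof.
move=> l12; rewrite codeP; split=> [h n nM|h m ml2].
  split=> m ml; have := h m; rewrite ?ml.
    move=> /(_ (leq_trans ml l12))/layer_true/wordP/(_ n nM).
    by rewrite /= => ->.
  move=> /(_ isT)/(layer_le (v' := false) (fun e => False_rect _ (notF e))).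
  by move=> /layer_false/wordP; apply.
apply/ffunP => n; have [h1 h2] := h n (ltn_ord n).
by rewrite !ffunE /visible h2//; case: ifP => // /h1 ->.
Qed.

(** At scale [a ^- l1] in the first and [b ^- l2] in the second coordinate, a
    point has a bounded number of neighbouring codes in each of its [M] visible
    coordinates: the leading digits form an integer within distance 3. *)
Lemma card_codes_near l1 l2 M z0 : (l1 <= l2)%N ->
  (#|values [set z | forall n, (n < M)%N ->
     (`|(coded_point z0).1 n - (coded_point z).1 n| <= 2 / a%:R ^+ l1)%R /\
     (`|(coded_point z0).2 n - (coded_point z).2 n| <= 2 / b%:R ^+ l2)%R]
    (code l1 l2 M)| <= 49 ^ M)%N.
Proof.
move=> l12.
pose A z n := (leading_value (fun m => (z m n).1) l1 + 3 -
  leading_value (fun m => (z0 m n).1) l1)%N.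
pose B z n := (leading_value (fun m => (z m n).2) l2 + 3 -
  leading_value (fun m => (z0 m n).2) l2)%N.
(* The differences of leading values lie in [-3, 3]; adding 3 makes them natural
   numbers below 7, so that the truncated subtraction loses nothing. *)
pose h z : {ffun 'I_M -> 'I_7 * 'I_7} :=
  [ffun n : 'I_M => (inord (A z n), inord (B z n))].
suff : (#|values [set z | forall n, (n < M)%N ->
     (`|(coded_point z0).1 n - (coded_point z).1 n| <= 2 / a%:R ^+ l1)%R /\
     (`|(coded_point z0).2 n - (coded_point z).2 n| <= 2 / b%:R ^+ l2)%R]
    (code l1 l2 M)| <= #|{: {ffun 'I_M -> 'I_7 * 'I_7}}|)%N.
  by rewrite card_ffun card_prod !card_ord.
apply: (card_values_inj (h := h)) => z z' Pz Pz' /ffunP hh.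
apply/code_digits => // n nM.
have := hh (Ordinal nM); rewrite !ffunE /= => -[].
have [/[dup]] := Pz n nM; rewrite {1}distrC.
move=> /(leading_value_close a1) u1 /(leading_value_close a1) u2.
move=> /[dup]; rewrite {1}distrC.
move=> /(leading_value_close b1) u3 /(leading_value_close b1) u4.
have [/[dup]] := Pz' n nM; rewrite {1}distrC.
move=> /(leading_value_close a1) u1' /(leading_value_close a1) u2'.
move=> /[dup]; rewrite {1}distrC.
move=> /(leading_value_close b1) u3' /(leading_value_close b1) u4'.
move=> /(congr1 val); rewrite /= !inordK; [|rewrite /A; lia..] => eA.
move=> /(congr1 val); rewrite /= !inordK; [|rewrite /B; lia..] => eB.
split.
  by apply: (leading_value_inj a1); move: eA; rewrite /A; lia.
by apply: (leading_value_inj b1); move: eB; rewrite /B; lia.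
Qed.

End Carpet.

(** * Counting codes in balls *)

Lemma card_family_prod (I : finType) (J : finType) (F : I -> {set J}) :
  #|family F| = (\prod_i #|F i|)%N.
Proof. by rewrite card_family foldrE big_map big_enum. Qed.

Lemma double_le_div (R : realType) (x y s : R) :
  0 < s -> x <= y -> y * s <= 1 -> 2 * x <= 2 / s.
Proof.
move=> s0 xy ys; rewrite ler_pM2l// -[leRHS]mul1r ler_pdivlMr//.
by apply: le_trans ys; rewrite ler_pM2r.
Qed.

Section BallCount.
Variables (R : realType) (a b : nat).
Hypotheses (a1 : (1 < a)%N) (b1 : (1 < b)%N).
Variable Omega : set (nat -> 'I_a * 'I_b).
Hypothesis hsub : subshift Omega.
Hypothesis hne : Omega !=set0.
Implicit Types (z : nat -> nat -> 'I_a * 'I_b) (w : nat -> 'I_a * 'I_b).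
Variables (L1 L2 l1 l2 : nat).

Local Notation X := (carpet R Omega).
Local Notation dist M := (bowen_dist (@shift_pair R) carpet_dist M).
Local Notation point := (@coded_point R a b).
Local Notation Omega' := (proj2 @` Omega).

Let O_shift w : Omega w -> Omega (shift_seq w).
Proof. by move=> Ow; apply: hsub.2; exists w. Qed.

Let cm := carpet_coordinate_metric R a1 b1 O_shift.

(** The number of [M]-words that the level [m] of a code can show, given a ball
    that fixes the first coordinates of the levels below [L1] and the second
    coordinates of those below [L2]. In between, the words over a known
    projection count, and their number is [f M]: the largest column for upper
    bounds and the largest fibre for lower bounds. *)
Definition layer_count (f : nat -> nat) M m : nat :=
  if (m < L1)%N then 1
  else if (m < L2)%N then (if (m < l1)%N then f M else 1)
  else if (m < l1)%N then word_count Omega M else word_count Omega' M.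

Lemma card_layer_le M m w0 : (L1 <= L2)%N -> (L1 <= l1)%N ->
  (#|values [set w | Omega w /\ ((m < L2)%N ->
       layer (m < L1)%N M w = layer (m < L1)%N M w0)] (layer (m < l1)%N M)|
    <= layer_count (max_column Omega) M m)%N.
Proof.
move=> L12 Ll1; rewrite /layer_count; case: ifP => mL1.
  apply: card_values_le1 => w w' [_ /(_ (leq_trans mL1 L12)) e].
  move=> [_ /(_ (leq_trans mL1 L12)) e']; rewrite (leq_trans mL1 Ll1).
  by rewrite e e'.
case: ifP => mL2.
  case: ifP => ml1.
    apply: (@leq_trans #|values [set w | Omega w /\
        word M (proj2 w) = word M (proj2 w0)] (word M)|); last first.
      exact: (leq_bigmax (word M (proj2 w0))).
    apply: (@leq_trans #|values [set w | Omega w /\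
        word M (proj2 w) = word M (proj2 w0)] (layer true M)|).
      apply: card_values_subset => w [Ow /(_ isT) /layer_false]; by split.
    by apply: card_values_determined => w w' _ _ /layer_true.
  by apply: card_values_le1 => w w' [_ /(_ isT) ->] [_ /(_ isT) ->].
case: ifP => ml1.
  apply: (@leq_trans #|values Omega (layer true M)|).
    by apply: card_values_subset => w [].
  by apply: card_values_determined => w w' _ _ /layer_true.
apply: (@leq_trans #|values Omega (layer false M)|).
  by apply: card_values_subset => w [].
apply: (@leq_trans #|values Omega (word M \o proj2)|).
  by apply: card_values_determined => w w' _ _ /layer_false.
by apply: card_values_comp => w Ow; exists w.
Qed.

Lemma card_codes_same_coarse M z0 (P : set (nat -> nat -> 'I_a * 'I_b)) :
  (L1 <= L2)%N -> (L1 <= l1)%N -> (L2 <= l2)%N ->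
  (forall z, P z -> forall m, Omega (z m)) ->
  (#|values [set z | P z /\ code L1 L2 M z = code L1 L2 M z0] (code l1 l2 M)|
    <= \prod_(m < l2) layer_count (max_column Omega) M m)%N.
Proof.
move=> L12 Ll1 Ll2 PO.
pose F (m : 'I_l2) := values [set w | Omega w /\ ((m < L2)%N ->
  layer (m < L1)%N M w = layer (m < L1)%N M (z0 m))] (layer (m < l1)%N M).
apply: (@leq_trans #|family F|).
  apply/subset_leq_card/fintype.subsetP => _ /valuesP[z [Pz /codeP ez] <-].
  apply/familyP => m; rewrite ffunE; apply: mem_values; split; first exact: PO.
  exact: ez.
rewrite card_family_prod; apply: leq_prod => m _; exact: card_layer_le.
Qed.

(** The coarse code of a point of the ball is one of the [49 ^ M] neighbours of
    that of the centre, and then the levels can be counted separately. The [J]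
    further coordinates, which are seen only with small weights, contribute a
    factor that does not depend on [M]. *)
Lemma card_codes_ball M J z0 (r : R) :
  (L1 <= L2)%N -> (L1 <= l1)%N -> (L2 <= l2)%N ->
  Num.min r 1 * a%:R ^+ L1 <= 1 -> Num.min r 1 * b%:R ^+ L2 <= 1 ->
  (forall m, Omega (z0 m)) ->
  (#|values [set z | (forall m, Omega (z m)) /\ (dist M (point z0) (point z) <= r)%R]
      (code l1 l2 (M + J))|
    <= #|{: {ffun 'I_l2 -> {ffun 'I_J -> option 'I_a * 'I_b}}}| *
       (49 ^ M * \prod_(m < l2) layer_count (max_column Omega) M m))%N.
Proof.
move=> L12 Ll1 Ll2 rL1 rL2 Oz0.
pose P := [set z | (forall m, Omega (z m)) /\ (dist M (point z0) (point z) <= r)%R].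
rewrite mulnC.
apply: (@leq_trans (#|values P (code l1 l2 M)| *
    #|values P (fun z => code l1 l2 J (fun m => iter M shift_seq (z m)))|)).
  apply: card_values_pair => z z' _ _ /codeP e1 /codeP e2; apply/codeP => m ml.
  have := e1 m ml; have := e2 m ml; case: (m < l1)%N.
    move=> /layer_true h2 /layer_true h1; apply/layer_true; exact: word_add.
  move=> /layer_false h2 /layer_false h1; apply/layer_false.
  by apply: word_add; rewrite -?proj2_iter.
apply: leq_mul; last exact: max_card.
apply: (@leq_trans (#|values P (code L1 L2 M)| *
    \prod_(m < l2) layer_count (max_column Omega) M m)).
  apply: card_values_fiber => z1 Pz1.
  by apply: card_codes_same_coarse => // z [].
rewrite leq_mul2r; apply/orP; right.
apply: leq_trans (card_codes_near R a1 b1 M z0 L12).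
apply: card_values_subset => z [Oz zr] n nM.
have Xz0 := coded_point_carpet R a1 b1 Oz0.
have Xz := coded_point_carpet R a1 b1 Oz.
have := coord_le_bowen_dist cm Xz0 Xz nM.
have d1 := bowen_dist_le1 cm M Xz0 Xz.
have dr : dist M (point z0) (point z) <= Num.min r 1 by rewrite le_min zr.
rewrite /carpet_delta ge_max => /andP[h1 h2]; split.
  apply: le_trans h1 (double_le_div _ dr rL1).
  by rewrite exprn_gt0// ltr0n ltnW.
apply: le_trans h2 (double_le_div _ dr rL2).
by rewrite exprn_gt0// ltr0n ltnW.
Qed.

Lemma code_dist_le M J z z' c : (l1 <= l2)%N ->
  (forall m, Omega (z m)) -> (forall m, Omega (z' m)) -> 0 <= c ->
  (a%:R ^+ l1)^-1 <= c -> (b%:R ^+ l2)^-1 <= c ->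
  code l1 l2 (M + J) z = code l1 l2 (M + J) z' ->
  dist M (point z) (point z') <= c + 2^-1 ^+ J.
Proof.
move=> l12 Oz Oz' c0 ac bc /(code_digits _ _ _ l12) h.
apply: (bowen_dist_le_tail cm) => //; [exact: coded_point_carpet..|].
move=> n /h[h1 h2]; rewrite /carpet_delta ge_max; apply/andP; split.
  by apply: le_trans ac; apply: expansion_close.
by apply: le_trans bc; apply: expansion_close.
Qed.

(** The three inequalities with [rho / 6] put points with equal codes within distance
    [rho / 3]: half of it bounds the digits beyond the code, and half bounds the
    coordinates beyond [M + J]. *)
Lemma coverable_ball M J x (r rho : R) :
  (L1 <= L2)%N -> (L1 <= l1)%N -> (L2 <= l2)%N -> (l1 <= l2)%N ->
  Num.min r 1 * a%:R ^+ L1 <= 1 -> Num.min r 1 * b%:R ^+ L2 <= 1 -> 0 < rho ->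
  (a%:R ^+ l1)^-1 <= rho / 6 -> (b%:R ^+ l2)^-1 <= rho / 6 ->
  2^-1 ^+ J <= rho / 6 -> X x ->
  coverable X (dist M) (cball_in X (dist M) x r) rho
    (#|{: {ffun 'I_l2 -> {ffun 'I_J -> option 'I_a * 'I_b}}}| *
       (49 ^ M * \prod_(m < l2) layer_count (max_column Omega) M m)).
Proof.
move=> L12 Ll1 Ll2 l12 rL1 rL2 rho0 al bl Jl /carpetP[//|//|z0 Oz0 <-].
have cB := card_codes_ball M J L12 Ll1 Ll2 rL1 rL2 Oz0.
apply: (coverable_of_codes (pt := point) cm rho0 _ _ _ cB).
- by move=> z [Oz _]; exact: coded_point_carpet.
- by move=> p [/carpetP[//|//|z Oz <-] zr]; exists z.
move=> z z' [Oz _] [Oz' _] e.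
have c0 : 0 <= rho / 6 by rewrite divr_ge0// ltW.
apply: le_trans (code_dist_le l12 Oz Oz' c0 al bl e) _.
by move: Jl; lra.
Qed.

(** The lower bound comes from points whose levels are chosen independently: the
    levels below [L1] are those of a fixed point, those below [L2] have its
    projection, and the others are arbitrary. The fixed point is constantly
    [w0], where the fibre of [w0] has the maximal number of [M]-words. *)
Lemma ball_codes_ge M w0 : Omega w0 ->
  #|values (fibre Omega (proj2 w0)) (word M)| = max_fibre Omega M ->
  (\prod_(m < l2) layer_count (max_fibre Omega) M m <=
   #|values [set z | [/\ forall m, Omega (z m),
        forall m, (m < L1)%N -> z m = w0 &
        forall m, (m < L2)%N -> proj2 (z m) = proj2 w0]] (code l1 l2 M)|)%N.
Proof.
move=> Ow0 w0M.
pose G m := [set w | [/\ Omega w, (m < L1)%N -> w = w0 &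
  (m < L2)%N -> proj2 w = proj2 w0]].
pose F (m : 'I_l2) := values (G m) (layer (m < l1)%N M).
have G0 m : G m w0 by split.
apply: (@leq_trans #|family F|); last first.
  apply/subset_leq_card/fintype.subsetP => k /familyP kF.
  have /choice[z zP] m : exists w, G m w /\
      forall i : 'I_l2, val i = m -> layer (m < l1)%N M w = k i.
    have [ml|lm] := ltnP m l2; last first.
      by exists w0; split => // i im; have := ltn_ord i; rewrite ltnNge im lm.
    have /valuesP[w Gw wk] := kF (Ordinal ml); exists w; split => // i im.
    by rewrite (_ : i = Ordinal ml)//; exact: val_inj.
  apply/valuesP; exists z.
    by split=> m; have [[]] := zP m.
  by apply/ffunP => i; rewrite ffunE; have [_] := zP i; apply.
rewrite card_family_prod; apply: leq_prod => m _.
have : (0 < #|F m|)%N by apply: card_values_gt0; exists w0.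
rewrite /F /layer_count.
case: ifPn => // mL1; case: ifPn => mL2.
  case: ifP => // ml1 _; rewrite -w0M.
  apply: (@leq_trans #|values (fibre Omega (proj2 w0)) (layer true M)|).
    by apply: card_values_determined => w w' _ _ /layer_true.
  apply: card_values_subset => w [Ow /= ww0]; split => //.
  by rewrite (negbTE mL1).
have OG : Omega `<=` G m by move=> w Ow; split; rewrite ?(negbTE mL1) ?(negbTE mL2).
case: ifP => ml1 _.
  apply: (@leq_trans #|values Omega (layer true M)|); last exact: card_values_subset.
  by apply: card_values_determined => w w' _ _ /layer_true.
apply: (@leq_trans #|values Omega (layer false M)|); last exact: card_values_subset.
apply: (@leq_trans #|values Omega (word M \o proj2)|).
  apply/subset_leq_card/fintype.subsetP => u /valuesP[_ [w Ow <-] wu].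
  by apply/valuesP; exists w.
by apply: card_values_determined => w w' _ _ /layer_false.
Qed.

(** All the points chosen above share the digits that the radius [r] determines,
    and each set of diameter [rho] contains at most [49 ^ M] of their codes. *)
Lemma exists_ball_cover_ge M (r rho : R) :
  (l1 <= l2)%N -> 0 < r -> (a%:R ^+ L1)^-1 <= r -> (b%:R ^+ L2)^-1 <= r ->
  Num.min rho 1 * a%:R ^+ l1 <= 1 -> Num.min rho 1 * b%:R ^+ l2 <= 1 ->
  exists2 x, X x & forall n,
    coverable X (dist M) (cball_in X (dist M) x r) rho n ->
    (\prod_(m < l2) layer_count (max_fibre Omega) M m <= 49 ^ M * n)%N.
Proof.
move=> l12 r0 aL bL al bl; have [w0 Ow0 w0M] := max_fibre_attained hne M.
have Oc : forall m : nat, Omega (cst w0 m) by [].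
have Xc := coded_point_carpet R a1 b1 Oc.
exists (point (cst w0)) => // n cn.
apply: leq_trans (ball_codes_ge Ow0 w0M) _; pose P := [set z | [/\ forall m, Omega (z m),
  forall m, (m < L1)%N -> z m = w0 &
  forall m, (m < L2)%N -> proj2 (z m) = proj2 w0]].
apply: (codes_le_coverable (pt := point) _ _ cn).
  move=> z [Oz z1 z2]; have Xz := coded_point_carpet R a1 b1 Oz.
  split => //; apply: (bowen_dist_le_coord cm) => //; first exact: ltW.
  move=> k; rewrite /carpet_delta ge_max; apply/andP; split.
    by apply: le_trans aL; apply: expansion_close => // m mL; rewrite z1.
  apply: le_trans bL; apply: expansion_close => // m mL.
  by have /(congr1 (@^~ k)) := z2 m mL; rewrite /proj2 /= => ->.
move=> z0 [Oz0 _ _]; apply: leq_trans (card_codes_near R a1 b1 M z0 l12).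
apply: card_values_subset => z [[Oz _ _] /= zr] k kM.
have Xz0 := coded_point_carpet R a1 b1 Oz0.
have Xz := coded_point_carpet R a1 b1 Oz.
have := coord_le_bowen_dist cm Xz0 Xz kM.
have d1 := bowen_dist_le1 cm M Xz0 Xz.
have dr : dist M (point z0) (point z) <= Num.min rho 1 by rewrite le_min zr.
rewrite /carpet_delta ge_max => /andP[h1 h2]; split.
  apply: le_trans h1 (double_le_div _ dr al).
  by rewrite exprn_gt0// ltr0n ltnW.
apply: le_trans h2 (double_le_div _ dr bl).
by rewrite exprn_gt0// ltr0n ltnW.
Qed.

End BallCount.

(** * Local growth in terms of entropies *)

Lemma ln_natr_prod (R : realType) (I : finType) (g : I -> nat) :
  (forall i, 0 < g i)%N ->
  ln (\prod_i g i)%N%:R = \sum_i ln (g i)%:R :> R.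
Proof.
move=> g0.
suff [] : (0 < \prod_i g i)%N /\ ln (\prod_i g i)%N%:R = \sum_i ln (g i)%:R :> R by [].
elim/big_rec2: _ => [|i x n _ [n0 <-]]; first by rewrite ln1.
by rewrite muln_gt0 g0 n0 natrM lnM// posrE ltr0n.
Qed.

Section GrowthBounds.
Variables (R : realType) (a b : nat).
Hypotheses (a1 : (1 < a)%N) (b1 : (1 < b)%N).
Variable Omega : set (nat -> 'I_a * 'I_b).
Hypothesis hsub : subshift Omega.
Hypothesis hne : Omega !=set0.

Local Notation X := (carpet R Omega).
Local Notation Omega' := (proj2 @` Omega).

Definition h_omega : R := rate (log_count R (word_count Omega)).
Definition h_proj : R := rate (log_count R (word_count Omega')).
Definition h_fibre : R := rate (log_count R (max_fibre Omega)).

Definition layer_entropy L1 L2 l1 m : R :=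
  if (m < L1)%N then 0
  else if (m < L2)%N then (if (m < l1)%N then h_fibre else 0)
  else if (m < l1)%N then h_omega else h_proj.

Let Omega_iter m w : Omega w -> Omega (iter m shift_seq w).
Proof. exact: subshift_iter. Qed.

Let Omega'_iter m w : Omega' w -> Omega' (iter m shift_seq w).
Proof.
move=> [w' Ow' <-]; exists (iter m shift_seq w'); first exact: Omega_iter.
exact: proj2_iter.
Qed.

Let Omega_count_gt0 M : (0 < word_count Omega M)%N.
Proof. exact: card_values_gt0. Qed.

Let Omega'_count_gt0 M : (0 < word_count Omega' M)%N.
Proof. by apply: card_values_gt0; have [w Ow] := hne; exists (proj2 w); exists w. Qed.

Lemma cvg_log_count u : (forall n, 0 < u n)%N -> submultiplicative u ->
  (fun M => ln (u M)%:R / M%:R) @ \oo --> rate (log_count R u).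
Proof.
move=> u0 um; apply: (@cvg_rate R (log_count R u)) => [n|].
  exact: log_count_ge0.
exact: subadditive_log.
Qed.

Lemma layer_count_gt0 L1 L2 l1 f M m : (0 < f M)%N ->
  (0 < layer_count Omega L1 L2 l1 f M m)%N.
Proof. by move=> fM; rewrite /layer_count; do !case: ifP => _. Qed.

Lemma cvg_layer_count L1 L2 l1 f m : (forall n, 0 < f n)%N ->
  ((fun M => ln (f M)%:R / M%:R : R) @ \oo --> h_fibre) ->
  (fun M => ln (layer_count Omega L1 L2 l1 f M m)%:R / M%:R) @ \oo -->
  layer_entropy L1 L2 l1 m.
Proof.
have c1 : (fun M => ln 1%:R / M%:R : R) @ \oo --> (0 : R).
  by under eq_fun do rewrite ln1 mul0r; exact: cvg_cst.
move=> f0 cf; rewrite /layer_count /layer_entropy.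
case: ifP => _ //; case: ifP => _; first by case: ifP.
case: ifP => _; apply: cvg_log_count => //; apply: word_count_submul.
  exact: Omega_iter.
exact: Omega'_iter.
Qed.

Lemma cvg_layer_counts L1 L2 l1 l2 f : (forall n, 0 < f n)%N ->
  ((fun M => ln (f M)%:R / M%:R : R) @ \oo --> h_fibre) ->
  (fun M => ln (\prod_(m < l2) layer_count Omega L1 L2 l1 f M m)%N%:R / M%:R)
    @ \oo --> \sum_(m < l2) layer_entropy L1 L2 l1 m.
Proof.
move=> f0 cf.
have -> : (fun M => ln (\prod_(m < l2) layer_count Omega L1 L2 l1 f M m)%N%:R / M%:R)
   = (fun M => \sum_(m < l2) (ln (layer_count Omega L1 L2 l1 f M m)%:R / M%:R : R)).
  apply/funext => M; rewrite ln_natr_prod ?mulr_suml// => m.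
  exact: layer_count_gt0.
apply: cvg_big; first exact: add_continuous.
by move=> m _; exact: cvg_layer_count.
Qed.

Lemma half_exprn_ge (c l : nat) (e : R) : (1 < c)%N -> 2^-1 ^+ l <= e ->
  (c%:R ^+ l)^-1 <= e.
Proof.
move=> c1; apply: le_trans; rewrite -exprVn lerXn2r ?nnegrE ?invr_ge0//.
by rewrite lef_pV2 ?posrE ?ltr0n ?ler_nat// ltnW.
Qed.

Definition max_log_cover (r rho : R) M : \bar R :=
  ereal_sup [set log_cover X (@shift_pair R) carpet_dist M
    (cball_in X (bowen_dist (@shift_pair R) carpet_dist M) x r) rho | x in X].

(** The logarithm of the product over the levels of a code, divided by [M], tends
    to a sum of entropies. The factor [49 ^ M] becomes the constant [ln 49], which
    does not depend on the scales [r] and [rho]. *)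
Theorem local_growth_layers (r rho : R) : 0 < r -> 0 < rho -> exists s : R,
  [/\ (fun M => (M%:R^-1)%:E * max_log_cover r rho M)%E @ \oo --> s%:E,
      forall L1 L2 l1 l2, (L1 <= L2)%N -> (L1 <= l1)%N -> (L2 <= l2)%N ->
        (l1 <= l2)%N ->
        Num.min r 1 * a%:R ^+ L1 <= 1 -> Num.min r 1 * b%:R ^+ L2 <= 1 ->
        (a%:R ^+ l1)^-1 <= rho / 6 -> (b%:R ^+ l2)^-1 <= rho / 6 ->
        s <= ln 49 + \sum_(m < l2) layer_entropy L1 L2 l1 m &
      forall L1 L2 l1 l2, (l1 <= l2)%N ->
        (a%:R ^+ L1)^-1 <= r -> (b%:R ^+ L2)^-1 <= r ->
        Num.min rho 1 * a%:R ^+ l1 <= 1 -> Num.min rho 1 * b%:R ^+ l2 <= 1 ->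
        \sum_(m < l2) layer_entropy L1 L2 l1 m <= ln 49 + s].
Proof.
move=> r0 rho0.
have [J HJ] := half_exprn_le (divr_gt0 rho0 (ltr0n R 6)).
have O_shift w : Omega w -> Omega (shift_seq w).
  by move=> Ow; apply: hsub.2; exists w.
have cm := carpet_coordinate_metric R a1 b1 O_shift.
have [w0 Ow0] := hne.
have X0 : X !=set0.
  by exists (coded_point R (cst w0)); apply: coded_point_carpet.
pose N l2 f M L1 L2 l1 := (#|{: {ffun 'I_l2 -> {ffun 'I_J -> option 'I_a * 'I_b}}}| *
       (49 ^ M * \prod_(m < l2) layer_count Omega L1 L2 l1 f M m))%N.
have Q0 l2 : (0 < #|{: {ffun 'I_l2 -> {ffun 'I_J -> option 'I_a * 'I_b}}}|)%N.
  by apply/card_gt0P; exists (code l2 l2 J (cst w0)).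
have max_column_gt0 := max_column_gt0 hne.
have N0 l2 M L1 L2 l1 : (0 < N l2 (max_column Omega) M L1 L2 l1)%N.
  rewrite /N muln_gt0 Q0 muln_gt0 expn_gt0/= prodn_gt0// => m.
  exact: layer_count_gt0.
have fin M : exists2 n, (0 < n)%N & forall x, X x ->
    coverable X (bowen_dist (@shift_pair R) carpet_dist M)
     (cball_in X (bowen_dist (@shift_pair R) carpet_dist M) x r) rho n.
  exists (N J (max_column Omega) M 0 0 J)%N => // x Xx.
  by apply: coverable_ball => //;
    rewrite ?expr0 ?mulr1 ?ge_min ?lexx ?orbT//; exact: half_exprn_ge.
have [u [uE u0 usub]] := local_growth_subadditive cm X0 fin.
have cu : (fun M => u M / M%:R) @ \oo --> rate u by exact: cvg_rate.
have c49 : (fun M => (ln 49 * M%:R) / M%:R : R) @ \oo --> (ln 49 : R).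
  apply: (@cvg_trans _ ((fun _ : nat => ln 49 : R) @ \oo)); last exact: cvg_cst.
  apply: near_eq_cvg; exists 1%N => // M /= M0; rewrite mulfK//.
  by rewrite pnatr_eq0 -lt0n.
exists (rate u); split.
- rewrite /max_log_cover; apply: (cvge_rate (J := 0)) => // M.
    by rewrite uE.
  by rewrite addn0 uE.
- move=> L1 L2 l1 l2 L12 Ll1 Ll2 l12 rL1 rL2 al bl.
  pose Q := #|{: {ffun 'I_l2 -> {ffun 'I_J -> option 'I_a * 'I_b}}}|.
  pose G M := (\prod_(m < l2) layer_count Omega L1 L2 l1 (max_column Omega) M m)%N.
  have G0 M : (0 < G M)%N by apply: prodn_gt0 => m; exact: layer_count_gt0.
  have cQ : (fun M => ln Q%:R / M%:R : R) @ \oo --> (0 : R).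
    rewrite -[X in _ --> X](mulr0 (ln Q%:R)); apply: cvgM; first exact: cvg_cst.
    apply/gtr0_cvgV0; last exact: cvgr_idn.
    by exists 1%N => // n /= n0; rewrite ltr0n.
  have cG : (fun M => ln (G M)%:R / M%:R) @ \oo -->
      \sum_(m < l2) layer_entropy L1 L2 l1 m.
    apply: cvg_layer_counts => //; rewrite /h_fibre -(rate_max_column hsub hne R).
    by apply: cvg_log_count => //; exact: max_column_submul.
  rewrite -[leRHS]add0r; apply: (ler_cvg_to cu (cvgD cQ (cvgD c49 cG))).
  apply: nearW => M /=.
  change (u M / M%:R <= ln Q%:R / M%:R + (ln 49 * M%:R / M%:R + ln (G M)%:R / M%:R)).
  rewrite -!mulrDl ler_wpM2r ?invr_ge0//.
  have -> : ln Q%:R + (ln 49 * M%:R + ln (G M)%:R) =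
      ln (N l2 (max_column Omega) M L1 L2 l1)%:R :> R.
    rewrite /N -/Q -/(G M) natrM lnM ?posrE ?ltr0n ?muln_gt0 ?expn_gt0 ?G0 ?Q0//.
    rewrite natrM lnM ?posrE ?ltr0n ?expn_gt0// natrX lnXn//.

    by rewrite mulr_natr.
  rewrite -lee_fin -uE; apply/ereal_supP => _ [x Xx <-].
  apply: lne_covering_number_le; first exact: N0.
  exact: coverable_ball.
move=> L1 L2 l1 l2 l12 aL bL al bl.
pose G M := (\prod_(m < l2) layer_count Omega L1 L2 l1 (max_fibre Omega) M m)%N.
have max_fibre_gt0 := max_fibre_gt0 hne.
have G0 M : (0 < G M)%N by apply: prodn_gt0 => m; exact: layer_count_gt0.
have cG : (fun M => ln (G M)%:R / M%:R) @ \oo -->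
    \sum_(m < l2) layer_entropy L1 L2 l1 m.
  apply: cvg_layer_counts => //.
  by apply: cvg_log_count => //; exact: max_fibre_submul.
apply: (ler_cvg_to cG (cvgD c49 cu)); apply: nearW => M /=.
change (ln (G M)%:R / M%:R <= ln 49 * M%:R / M%:R + u M / M%:R).
rewrite -!mulrDl ler_wpM2r ?invr_ge0// -lerBlDl -lee_fin -uE.
have [x Xx Hx] := exists_ball_cover_ge a1 b1 hsub hne M l12 r0 aL bL al bl.
apply: le_ereal_sup_tmp; exists (log_cover X (@shift_pair R) carpet_dist M
  (cball_in X (bowen_dist (@shift_pair R) carpet_dist M) x r) rho).
  by exists x.
have -> : ln (G M)%:R - ln 49 * M%:R = ln ((G M)%:R / (49 ^ M)%N%:R) :> R.
  by rewrite ln_div ?posrE ?ltr0n ?expn_gt0// natrX lnXn// mulr_natr.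
apply: lne_covering_number_ge; first by rewrite divr_gt0 ?ltr0n ?expn_gt0.
move=> n n0 /Hx h; rewrite ler_pdivrMr ?ltr0n ?expn_gt0// -natrM ler_nat mulnC.
exact: h.
Qed.

End GrowthBounds.

(** * The growth exponent of balls *)

Lemma sum_interval lo hi k :
  (\sum_(m < k) ((lo <= m) && (m < hi)) = minn k hi - lo)%N.
Proof. elim: k => [|k IH]; first by rewrite big_ord0; lia.
by rewrite big_ord_recr/= IH; lia. Qed.

Lemma scale_le1 (R : realType) (c L : nat) (x : R) : (1 < c)%N -> 0 < x ->
  L%:R * ln c%:R <= - ln x -> x * c%:R ^+ L <= 1.
Proof.
move=> c1 x0 h; have c0 : 0 < c%:R :> R by rewrite ltr0n ltnW.
rewrite -ler_ln ?posrE ?ltr01 ?mulr_gt0 ?exprn_gt0//.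
rewrite ln1 lnM ?posrE ?exprn_gt0// lnXn// -[_ *+ L]mulr_natl; lra.
Qed.

Lemma scale_inv_le (R : realType) (c L : nat) (x : R) : (1 < c)%N -> 0 < x ->
  - ln x <= L%:R * ln c%:R -> (c%:R ^+ L)^-1 <= x.
Proof.
move=> c1 x0 h; have c0 : 0 < c%:R :> R by rewrite ltr0n ltnW.
rewrite -ler_ln ?posrE ?invr_gt0 ?exprn_gt0//.
by rewrite lnV ?posrE ?exprn_gt0// lnXn// -[_ *+ L]mulr_natl; lra.
Qed.

(** The real numbers [p], [q], [u], [v] are the quotients of the logarithmic scales
    by [ln a] and [ln b], and [At], [AS], [Bt], [BS] are their integer parts. Changing
    the numbers of digits by a bounded amount changes the growth by a bounded
    amount. *)
Section Rounding.
Variables (R : realFieldType) (p q u v At AS Bt BS hc h' D : R).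
Hypotheses (hc0 : 0 <= hc) (h'0 : 0 <= h') (D0 : 0 <= D).
Hypotheses (At_le : At <= p) (At_gt : p < At + 1) (AS_le : AS <= q) (AS_gt : q < AS + 1).
Hypotheses (Bt_le : Bt <= u) (Bt_gt : u < Bt + 1) (BS_le : BS <= v) (BS_gt : v < BS + 1).

Let max_le (x y : R) : x <= y -> Num.max 0 x * D <= Num.max 0 y * D.
Proof. by move=> xy; rewrite ler_wpM2r// ge_max !le_max lexx/= xy orbT. Qed.

Lemma rounding_ge :
  (p - q) * hc + (u - v) * h' - Num.max 0 (p - v) * D - 2 * (hc + h') <=
  (At - (AS + 1)) * hc + (Bt - (BS + 1)) * h' - Num.max 0 (At - (BS + 1)) * D.
Proof.
have H1 : Num.max 0 (At - (BS + 1)) * D <= Num.max 0 (p - v) * D by apply: max_le; move: At_le BS_gt; lra.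
have H2 : (p - q - 2) * hc <= (At - (AS + 1)) * hc by apply: ler_wpM2r => //; move: At_gt AS_le; lra.
have H3 : (u - v - 2) * h' <= (Bt - (BS + 1)) * h' by apply: ler_wpM2r => //; move: Bt_gt BS_le; lra.
by move: H1 H2 H3; set m1 := Num.max _ _ * D; set m2 := Num.max _ _ * D; lra.
Qed.

Lemma rounding_le :
  (At + 4 - AS) * hc + (Bt + 4 - BS) * h' - Num.max 0 (At + 4 - BS) * D <=
  (p - q) * hc + (u - v) * h' - Num.max 0 (p - v) * D + 5 * (hc + h').
Proof.
have H1 : Num.max 0 (p - v) * D <= Num.max 0 (At + 4 - BS) * D by apply: max_le; move: At_gt BS_le; lra.
have H2 : (At + 4 - AS) * hc <= (p - q + 5) * hc by apply: ler_wpM2r => //; move: At_le AS_gt; lra.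
have H3 : (Bt + 4 - BS) * h' <= (u - v + 5) * h' by apply: ler_wpM2r => //; move: Bt_le BS_gt; lra.
by move: H1 H2 H3; set m1 := Num.max _ _ * D; set m2 := Num.max _ _ * D; lra.
Qed.

End Rounding.

Section Exponent.
Variables (R : realType) (a b : nat).
Hypotheses (b1 : (1 < b)%N) (ab : (b < a)%N).
Variable Omega : set (nat -> 'I_a * 'I_b).
Hypothesis hsub : subshift Omega.
Hypothesis hne : Omega !=set0.

Local Notation X := (carpet R Omega).
Local Notation Omega' := (proj2 @` Omega).
Local Notation h := (h_omega R Omega).
Local Notation h' := (h_proj R Omega).
Local Notation hc := (h_fibre R Omega).

Let a1 : (1 < a)%N. Proof. exact: ltn_trans ab. Qed.

Lemma h_fibre_ge0 : 0 <= hc.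
Proof.
by apply: rate_ge0 => n; apply: log_count_ge0; exact: max_fibre_gt0.
Qed.

Let Omega'_count_gt0 M : (0 < word_count Omega' M)%N.
Proof. by apply: card_values_gt0; have [w Ow] := hne; exists (proj2 w); exists w. Qed.

Lemma h_proj_ge0 : 0 <= h'.
Proof. by apply: rate_ge0 => n; exact: log_count_ge0. Qed.

Lemma h_omega_le : h <= hc + h'.
Proof.
have c1 : (fun M => ln (word_count Omega M)%:R / M%:R) @ \oo --> h.
  apply: cvg_log_count => [n|]; first exact: card_values_gt0.
  by apply: word_count_submul => m w; exact: subshift_iter.
have c2 : (fun M => ln (word_count Omega' M)%:R / M%:R) @ \oo --> h'.
  apply: cvg_log_count => //; apply: word_count_submul => m _ [w Ow <-].
  exists (iter m shift_seq w); [exact: subshift_iter|exact: proj2_iter].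
have c3 : (fun M => ln (max_column Omega M)%:R / M%:R) @ \oo --> hc.
  rewrite /h_fibre -(rate_max_column hsub hne R).
  by apply: cvg_log_count => [n|]; [exact: max_column_gt0|exact: max_column_submul].
apply: (ler_cvg_to c1 (cvgD c3 c2)); apply: nearW => M /=.
change (ln (word_count Omega M)%:R / M%:R <=
  ln (max_column Omega M)%:R / M%:R + ln (word_count Omega' M)%:R / M%:R :> R).
have m0 := max_column_gt0 hne M; have w0 : (0 < word_count Omega M)%N.
  exact: card_values_gt0.
rewrite -mulrDl ler_wpM2r ?invr_ge0// -lnM ?posrE ?ltr0n// -natrM.
rewrite ler_ln ?posrE ?ltr0n ?muln_gt0 ?m0 ?Omega'_count_gt0// ler_nat mulnC.
exact: word_count_le_column.
Qed.

Local Notation Delta := (hc + h' - h).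

Lemma sum_layer_entropy L1 L2 l1 l2 : (L1 <= L2)%N -> (l1 <= l2)%N ->
  \sum_(m < l2) layer_entropy R Omega L1 L2 l1 m =
  hc * (minn L2 l1 - L1)%N%:R + h * (l1 - L2)%N%:R + h' * (l2 - maxn L2 l1)%N%:R.
Proof.
move=> L12 l12.
have E (m : 'I_l2) : layer_entropy R Omega L1 L2 l1 m =
    hc * ((L1 <= m) && (m < minn L2 l1))%N%:R +
    h * ((L2 <= m) && (m < l1))%N%:R +
    h' * ((maxn L2 l1 <= m) && (m < l2))%N%:R.
  have ml2 := ltn_ord m; rewrite /layer_entropy.
  case: ifP => mL1.
    have -> : (L1 <= m)%N = false by lia.
    have -> : (L2 <= m)%N = false by lia.
    have -> : (maxn L2 l1 <= m)%N = false by lia.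
    by rewrite /= !mulr0 !addr0.
  case: ifP => mL2.
    have -> : (L2 <= m)%N = false by lia.
    have -> : (maxn L2 l1 <= m)%N = false by lia.
    have -> : ((L1 <= m) && (m < minn L2 l1))%N = (m < l1)%N by lia.
    by case: ifP => _; rewrite /= !mulr0 ?mulr1 !addr0.
  have -> : ((L1 <= m) && (m < minn L2 l1))%N = false by lia.
  have -> : (L2 <= m)%N = true by lia.
  case: ifP => ml1.
    have -> : (maxn L2 l1 <= m)%N = false by lia.
    by rewrite /= !mulr0 mulr1 add0r addr0.
  have -> : (maxn L2 l1 <= m)%N = true by lia.
  by rewrite ml2 /= !mulr0 mulr1 !add0r.
rewrite (eq_bigr _ (fun m _ => E m)) !big_split/= -!mulr_sumr -!natr_sum.
rewrite !sum_interval; congr (_ * _%:R + _ * _%:R + _ * _%:R); lia.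
Qed.

(** The entropy [h] of the levels below [l1] whose coordinates are both free is
    written as [hc + h'] minus [Delta], which makes the rest of the sum linear. *)
Lemma sum_layer_entropy_ge L1 L2 l1 l2 : (L1 <= L2)%N -> (l1 <= l2)%N ->
  (l1%:R - L1%:R) * hc + (l2%:R - L2%:R) * h' - Num.max 0 (l1%:R - L2%:R) * Delta
  <= \sum_(m < l2) layer_entropy R Omega L1 L2 l1 m.
Proof.
move=> L12 l12; rewrite sum_layer_entropy//.
have hc0 := h_fibre_ge0; have h'0 := h_proj_ge0.
have sub (m n : nat) : m%:R - n%:R <= (m - n)%N%:R :> R.
  have [mn|nm] := leqP m n; last by rewrite natrB// ltnW.
  by rewrite (eqP (_ : m - n == 0)%N)// subr_le0 ler_nat.
have [lL|Ll] := leqP l1 L2.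
  have -> : Num.max 0 (l1%:R - L2%:R) = 0 :> R by apply/max_idPl; rewrite subr_le0 ler_nat.
  rewrite (eqP (_ : l1 - L2 == 0)%N)// mulr0 mul0r subr0 addr0.
  by rewrite ![_ * hc]mulrC ![_ * h']mulrC lerD// ler_wpM2l.
have -> : Num.max 0 (l1%:R - L2%:R) = l1%:R - L2%:R :> R.
  by apply/max_idPr; rewrite subr_ge0 ler_nat ltnW.
by rewrite !natrB ?(ltnW Ll)//; lra.
Qed.

Lemma sum_layer_entropy_le L1 L2 l1 l2 : (L1 <= L2)%N -> (l1 <= l2)%N ->
  (L1 <= l1)%N -> (L2 <= l2)%N ->
  \sum_(m < l2) layer_entropy R Omega L1 L2 l1 m <=
  (l1%:R - L1%:R) * hc + (l2%:R - L2%:R) * h' - Num.max 0 (l1%:R - L2%:R) * Delta.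
Proof.
move=> L12 l12 Ll1 Ll2; rewrite sum_layer_entropy//.
have [lL|Ll] := leqP l1 L2.
  have -> : Num.max 0 (l1%:R - L2%:R) = 0 :> R by apply/max_idPl; rewrite subr_le0 ler_nat.
  rewrite (eqP (_ : l1 - L2 == 0)%N)// !natrB//; lra.
have -> : Num.max 0 (l1%:R - L2%:R) = l1%:R - L2%:R :> R.
  by apply/max_idPr; rewrite subr_ge0 ler_nat ltnW.
by rewrite !natrB ?(ltnW Ll)//; lra.
Qed.

(** Here [s = - ln r] and [t = - ln rho]. Every digit in base [a] between the two
    scales contributes [hc] and every digit in base [b] contributes [h']. At the
    levels where both digits of a symbol are free, [hc + h'] overestimates the
    entropy [h] by [Delta]. *)
Definition growth_exponent (s t : R) : R :=
  (t - s) * (hc / ln a%:R + h' / ln b%:R) -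
  Num.max 0 (t / ln a%:R - s / ln b%:R) * Delta.

(** The carpet has diameter at most 1, so that larger scales behave like 1. *)
Definition neg_log (r : R) : R := - ln (Num.min r 1).

Lemma neg_log_ge0 r : 0 < r -> 0 <= neg_log r.
Proof.
by move=> r0; rewrite oppr_ge0 ln_le0// ge_min lexx orbT.
Qed.

Lemma neg_log_le r rho : 0 < rho -> rho <= r -> neg_log r <= neg_log rho.
Proof.
move=> rho0 rr; have r0 := lt_le_trans rho0 rr.
rewrite lerN2 ler_ln ?posrE ?lt_min ?rho0 ?r0 ?ltr01//.
by rewrite le_min !ge_min rr lexx !orbT.
Qed.

Lemma lnb_gt0 : 0 < ln b%:R :> R. Proof. by rewrite ln_gt0// ltr1n. Qed.

Lemma lnab : ln b%:R < ln a%:R :> R.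
Proof. by rewrite ltr_ln ?posrE ?ltr0n ?ltr_nat// ltnW. Qed.

Let lna_gt0 : 0 < ln a%:R :> R. Proof. exact: lt_trans lnb_gt0 lnab. Qed.

(** For the upper bound the digits fixed by the ball are rounded down and those
    needed to separate points are rounded up; for the lower bound it is the
    other way round. *)
Theorem local_growth_estimate : exists C : R, forall r rho, 0 < rho -> rho <= r ->
  exists2 s : R, (fun M => (M%:R^-1)%:E * max_log_cover Omega r rho M)%E @ \oo
      --> s%:E &
    `|s - growth_exponent (neg_log r) (neg_log rho)| <= C.
Proof.
exists (ln 49 + 5 * (hc + h')) => r rho rho0 rr.
have r0 := lt_le_trans rho0 rr.
have [s [sE s_le s_ge]] := local_growth_layers a1 b1 hsub hne r0 rho0.
exists s => //.
have S0 := neg_log_ge0 r0; have St := neg_log_le rho0 rr.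
have r_scale : - ln (Num.min r 1) = neg_log r by [].
have rho_scale : - ln (Num.min rho 1) = neg_log rho by [].
move: (neg_log r) (neg_log rho) S0 St r_scale rho_scale => S t S0 St r_scale rho_scale.
have t0 : 0 <= t by exact: le_trans St.
have la := lna_gt0; have lb := lnb_gt0; have lab := lnab.
have hc0 := h_fibre_ge0; have h'0 := h_proj_ge0.
have D0 : 0 <= Delta by rewrite subr_ge0 h_omega_le.
have div_le x : 0 <= x -> x / ln a%:R <= x / ln b%:R :> R.
  by move=> x0; rewrite ler_wpM2l// lef_pV2 ?posrE// ltW.
have mr0 : 0 < Num.min r 1 by rewrite lt_min r0 ltr01.
have mrho0 : 0 < Num.min rho 1 by rewrite lt_min rho0 ltr01.
pose A x := Num.trunc (x / ln a%:R : R); pose B x := Num.trunc (x / ln b%:R : R).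
have Ap x : 0 <= x -> (A x)%:R <= x / ln a%:R < (A x)%:R + 1.
  by move=> x0; rewrite natr1 truncn_itv// divr_ge0// ltW.
have Bp x : 0 <= x -> (B x)%:R <= x / ln b%:R < (B x)%:R + 1.
  by move=> x0; rewrite natr1 truncn_itv// divr_ge0// ltW.
have AB x : 0 <= x -> (A x <= B x)%N by move=> x0; apply: le_truncn; exact: div_le.
have AA : (A S <= A t)%N by apply: le_truncn; rewrite ler_pM2r ?invr_gt0.
have BB : (B S <= B t)%N by apply: le_truncn; rewrite ler_pM2r ?invr_gt0.
clearbody A B.
have /andP[AS1 AS2] := Ap S S0; have /andP[At1 At2] := Ap t t0.
have /andP[BS1 BS2] := Bp S S0; have /andP[Bt1 Bt2] := Bp t t0.
have E : growth_exponent S t = (t / ln a%:R - S / ln a%:R) * hc +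
    (t / ln b%:R - S / ln b%:R) * h' - Num.max 0 (t / ln a%:R - S / ln b%:R) * Delta.
  by rewrite /growth_exponent; congr (_ - _); rewrite mulrDr; ring.
(* The last three digits supply the factor 1/6, as [2 ^ 3 >= 6]. *)
have fine c l : (1 < c)%N -> - ln (Num.min rho 1) <= l.+1%:R * ln c%:R ->
    (c%:R ^+ (l + 4))^-1 <= rho / 6.
  move=> c1 /(scale_inv_le c1 mrho0) hl; rewrite -addSnnS exprD invfM.
  apply: ler_pM; rewrite ?invr_ge0 ?exprn_ge0//.
    by apply: le_trans hl _; rewrite ge_min lexx.
  apply: (@le_trans _ _ ((2 : R) ^+ 3)^-1).
    by rewrite lef_pV2 ?posrE ?exprn_gt0 ?ltr0n 1?ltnW// lerXn2r ?nnegrE// ler_nat.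
  by rewrite lef_pV2 ?posrE ?exprn_gt0//; lra.
rewrite ler_distl E; apply/andP; split.
  have leA : (a%:R ^+ (A S).+1)^-1 <= r.
    apply: (@le_trans _ _ (Num.min r 1)); last by rewrite ge_min lexx.
    by apply: scale_inv_le => //; rewrite r_scale -ler_pdivrMr// -natr1 ltW.
  have leB : (b%:R ^+ (B S).+1)^-1 <= r.
    apply: (@le_trans _ _ (Num.min r 1)); last by rewrite ge_min lexx.
    by apply: scale_inv_le => //; rewrite r_scale -ler_pdivrMr// -natr1 ltW.
  have alA : Num.min rho 1 * a%:R ^+ A t <= 1.
    by apply: scale_le1 => //; rewrite rho_scale -ler_pdivlMr.
  have blB : Num.min rho 1 * b%:R ^+ B t <= 1.
    by apply: scale_le1 => //; rewrite rho_scale -ler_pdivlMr.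
  have H1 := s_ge _ _ _ _ (AB _ t0) leA leB alA blB.
  have H2 := @sum_layer_entropy_ge (A S).+1 (B S).+1 _ _ (AB _ S0) (AB _ t0).
  have H3 := rounding_ge hc0 h'0 D0 At1 At2 AS1 Bt2 BS1 BS2.
  rewrite ![_ + 1]natr1 in H3; have := le_trans H3 (le_trans H2 H1).
  rewrite -lerBlDl; apply: le_trans.
  rewrite opprD addrA [leRHS]addrAC lerD2l lerN2.
  by rewrite ler_wpM2r ?ler_nat// addr_ge0.
have leA : Num.min r 1 * a%:R ^+ A S <= 1.
  by apply: scale_le1 => //; rewrite r_scale -ler_pdivlMr.
have leB : Num.min r 1 * b%:R ^+ B S <= 1.
  by apply: scale_le1 => //; rewrite r_scale -ler_pdivlMr.
have alA : (a%:R ^+ (A t + 4))^-1 <= rho / 6.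
  by apply: fine => //; rewrite rho_scale -ler_pdivrMr// -natr1 ltW.
have blB : (b%:R ^+ (B t + 4))^-1 <= rho / 6.
  by apply: fine => //; rewrite rho_scale -ler_pdivrMr// -natr1 ltW.
have l12 : (A t + 4 <= B t + 4)%N by rewrite leq_add2r AB.
have Ll1 : (A S <= A t + 4)%N by apply: leq_trans AA (leq_addr _ _).
have Ll2 : (B S <= B t + 4)%N by apply: leq_trans BB (leq_addr _ _).
have H1 := s_le _ _ _ _ (AB _ S0) Ll1 Ll2 l12 leA leB alA blB.
have H2 := sum_layer_entropy_le (AB _ S0) l12 Ll1 Ll2.
have H3 := rounding_le hc0 h'0 D0 At1 At2 AS2 Bt1 BS1 BS2.
rewrite !natrD in H2; apply: le_trans H1 _; rewrite [leRHS]addrCA lerD2l.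
exact: le_trans H2 H3.
Qed.

End Exponent.

(** * Dimensions *)

Lemma limf_esup_einf_cvg (R : realType) (f : R -> \bar R) (l : R) :
  f @ 0^'+ --> l%:E -> limf_esup f 0^'+ = l%:E /\ limf_einf f 0^'+ = l%:E.
Proof.
move=> fl.
have esup_le (g : R -> \bar R) (m : R) : g @ 0^'+ --> m%:E ->
    (limf_esup g 0^'+ <= m%:E)%E.
  move=> gm; rewrite limf_esupE; apply/lee_addgt0Pr => e e0.
  apply: ge_ereal_inf; exists (ereal_sup [set g x | x in
      [set x | (g x <= (m + e)%:E)%E]]); last first.
    by apply/ereal_supP => _ [x /= gx <-]; rewrite -EFinD.
  exists [set x | (g x <= (m + e)%:E)%E] => //.
  have me : ((m + e)%:E > m%:E)%E by rewrite lte_fin ltrDl.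
  have gme : \forall x \near 0^'+, (g x < (m + e)%:E)%E.
    exact: gm (open_nbhs_nbhs (conj (@open_ereal_lt_ereal R _) me)).
  by apply: filterS gme => x /ltW.
have esup_ge (g : R -> \bar R) (m : R) : g @ 0^'+ --> m%:E ->
    (m%:E <= limf_esup g 0^'+)%E.
  move=> gm; rewrite limf_esupE; apply/ereal_infP => _ [V FV <-].
  apply/lee_subgt0Pr => e e0.
  have me : ((m - e)%:E < m%:E)%E by rewrite lte_fin gtrBl.
  have gV : \forall x \near 0^'+, ((m - e)%:E < g x)%E.
    exact: gm (open_nbhs_nbhs (conj (@open_ereal_gt_ereal R _) me)).
  have [x [Vx /= mx]] : exists x, V x /\ ((m - e)%:E < g x)%E.
    exact: (filter_ex (filterI FV gV)).
  by apply: le_ereal_sup_tmp; exists (g x); [exists x|rewrite -EFinB ltW].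
split; first by apply/le_anti; rewrite esup_le// esup_ge.
have Nfl : (\- f)%E @ 0^'+ --> (- l)%:E by rewrite EFinN; exact: cvgeN.
have /eqP : limf_esup (\- f)%E 0^'+ = (- l)%:E.
  by apply/le_anti; rewrite esup_le// esup_ge.
by rewrite limf_esupN EFinN eqe_opp => /eqP.
Qed.

Lemma le_of_mul_bound (R : realType) (x y C : R) :
  (forall T, 0 < T -> T * x <= T * y + C) -> x <= y.
Proof.
move=> h; rewrite leNgt; apply/negP => yx.
have C0 : 0 < `|C| + 1 by rewrite ltr_wpDl.
have xy0 : 0 < x - y by rewrite subr_gt0.
have := h ((`|C| + 1) / (x - y)) (divr_gt0 C0 xy0).
rewrite -lerBlDl -mulrBr divfK ?gt_eqF//.
have := ler_norm C; lra.
Qed.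

Lemma le_expR_powR (R : realType) (C s g x : R) : 0 < x ->
  (expeR g%:E <= (expR C * x `^ s)%:E)%E = (g <= C + s * ln x).
Proof.
move=> x0; rewrite lee_fin /powR gt_eqF// -expRD ler_expR//.
Qed.

(** If the local growth is linear in [ln (r / rho)] up to a bounded error, then
    its slope is the infimum of the admissible exponents. *)
Lemma inf_exponents (R : realType) (I : Type) (A : set I) (G : I -> \bar R)
    (x : I -> R) (k C : R) :
  0 <= k -> (forall i, A i -> 1 <= x i) ->
  (forall i, A i -> exists2 g : R, G i = g%:E & g <= C + k * ln (x i)) ->
  (forall T, 0 < T -> exists i, [/\ A i, ln (x i) = T &
     exists2 g : R, G i = g%:E & k * T - C <= g]) ->
  ereal_inf [set s%:E | s in [set s : R | 0 < s /\ exists2 D : R, 0 < D &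
    forall i, A i -> (expeR (G i) <= (D * x i `^ s)%:E)%E]] = k%:E.
Proof.
move=> k0 x1 Gle Gge; apply/le_anti/andP; split.
  apply/lee_addgt0Pr => e e0; apply: ereal_inf_lbound; exists (k + e) => //.
  split; first by rewrite ltr_wpDl.
  exists (expR C); first exact: expR_gt0.
  move=> i Ai; have [g -> gle] := Gle i Ai; have xi := x1 i Ai.
  rewrite le_expR_powR ?(lt_le_trans ltr01)//; apply: le_trans gle _.
  by rewrite lerD2l ler_wpM2r ?ln_ge0// lerDl ltW.
apply/ereal_infP => _ [s [s0 [D D0 HD]] <-]; rewrite lee_fin.
apply: (@le_of_mul_bound _ _ _ (C + ln D)) => T T0.
have [i [Ai xT [g Gg gge]]] := Gge T T0.
have xi := lt_le_trans ltr01 (x1 i Ai).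
have := HD i Ai; rewrite Gg -[D in (D * _)]lnK// le_expR_powR// xT => h.
by move: gge h; rewrite ![T * _]mulrC; lra.
Qed.

Section Dimensions.
Variables (R : realType) (a b : nat).
Hypotheses (b1 : (1 < b)%N) (ab : (b < a)%N).
Variable Omega : set (nat -> 'I_a * 'I_b).
Hypothesis hsub : subshift Omega.
Hypothesis hne : Omega !=set0.

Local Notation X := (carpet R Omega).
Local Notation h := (h_omega R Omega).
Local Notation h' := (h_proj R Omega).
Local Notation hc := (h_fibre R Omega).
Local Notation la := (ln a%:R : R).
Local Notation lb := (ln b%:R : R).
Local Notation Delta := (hc + h' - h).
Local Notation growth := (local_growth X (@shift_pair R) carpet_dist).

Definition assouad_dim : R := hc / la + h' / lb.

(** With [rho = r ^ (1 / theta)] both scales are proportional to [- ln r], and the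
    truncated term is the loss coming from the levels with two free digits. *)
Definition spectrum_dim (theta : R) : R :=
  assouad_dim - Num.max 0 (la^-1 - theta / lb) * Delta / (1 - theta).

Let lb0 : 0 < lb := lnb_gt0 R b1.
Let lab : lb < la := lnab R b1 ab.
Let la0 : 0 < la := lt_trans lb0 lab.
Let hc0 : 0 <= hc := h_fibre_ge0 R hne.
Let h'0 : 0 <= h' := h_proj_ge0 R hne.
Let D0 : 0 <= Delta.
Proof. by rewrite subr_ge0 h_omega_le. Qed.
Let h0 : 0 <= h.
Proof. by apply: rate_ge0 => n; apply: log_count_ge0; exact: card_values_gt0. Qed.

Lemma growth_exponent_le s t : s <= t ->
  growth_exponent Omega s t <= (t - s) * assouad_dim.
Proof.
by move=> st; rewrite lerBlDr lerDl mulr_ge0 ?le_max ?lexx.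
Qed.

Lemma growth_exponent_power theta s : 0 < theta < 1 -> 0 <= s ->
  growth_exponent Omega s (theta^-1 * s) =
  (theta^-1 - 1) * s * spectrum_dim theta.
Proof.
move=> /andP[t0 t1] s0; rewrite /growth_exponent /spectrum_dim -/assouad_dim.
have -> : Num.max 0 (theta^-1 * s / la - s / lb) =
    theta^-1 * s * Num.max 0 (la^-1 - theta / lb).
  rewrite maxr_pMr ?mulr0; last by rewrite mulr_ge0// invr_ge0 ltW.
  by congr Num.max; field; rewrite !gt_eqF.
set m := Num.max _ _; field.
by rewrite subr_eq0 !gt_eqF.
Qed.

Lemma spectrum_dim_ge0 theta : 0 < theta < 1 -> 0 <= spectrum_dim theta.
Proof.
move=> /andP[t0 t1]; have t10 : 0 < 1 - theta by rewrite subr_gt0.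
have dl : lb^-1 - la^-1 >= 0 by rewrite subr_ge0 lef_pV2 ?posrE// ltW.
have ila : 0 < la^-1 by rewrite invr_gt0.
have ilb : 0 < lb^-1 by rewrite invr_gt0.
rewrite /spectrum_dim /assouad_dim subr_ge0 ler_pdivrMr//.
move: ila ilb dl hc0 h'0 h0; set x := la^-1; set y := lb^-1.
move=> x0 y0 xy hc0_ h'0_ h0_.
have [le0|gt0] := leP (x - theta * y) 0.
  rewrite mul0r mulr_ge0 ?(ltW t10)//.
  by apply: addr_ge0; apply: mulr_ge0 => //; rewrite ltW.
have e1 : 0 <= h * (x - theta * y) by rewrite mulr_ge0// ltW.
have e2 : 0 <= h' * (y - x) by rewrite mulr_ge0.
have e3 : 0 <= theta * (hc * (y - x)) by rewrite mulr_ge0 ?(ltW t0)// mulr_ge0.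
rewrite -subr_ge0.
have -> : (hc * x + h' * y) * (1 - theta) - (x - theta * y) * Delta =
  h * (x - theta * y) + h' * (y - x) + theta * (hc * (y - x)) by ring.
by rewrite !addr_ge0.
Qed.

Lemma neg_log_lt1 (r : R) : r < 1 -> neg_log r = - ln r.
Proof. by move=> r1; rewrite /neg_log (min_idPl _)// ltW. Qed.

Lemma neg_log_sub_le (r rho : R) : 0 < rho -> rho <= r ->
  neg_log rho - neg_log r <= ln (r / rho).
Proof.
move=> rho0 rr; have r0 := lt_le_trans rho0 rr.
rewrite ln_div ?posrE// /neg_log.
have lrr : ln rho <= ln r by rewrite ler_ln ?posrE.
have [rho1|rho1] := leP rho 1; have [r1|r1] := leP r 1.
- by rewrite opprK addrC.
- by rewrite ln1 oppr0 subr0 lerDr ln_ge0// ltW.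
- by have := lt_le_trans rho1 (le_trans rr r1); rewrite ltxx.
- by rewrite ln1 subrr subr_ge0.
Qed.

Lemma growth_estimate : exists C : R, forall r rho, 0 < rho -> rho <= r ->
  exists2 g : R, growth r rho = g%:E &
    `|g - growth_exponent Omega (neg_log r) (neg_log rho)| <= C.
Proof.
have [C HC] := local_growth_estimate R b1 ab hsub hne.
exists C => r rho rho0 rr; have [g gc gC] := HC r rho rho0 rr.
by exists g => //; apply/cvg_lim.
Qed.

Lemma ln_power_ratio (theta r : R) : 0 < theta < 1 -> 0 < r ->
  ln (r / r `^ theta^-1) = (theta^-1 - 1) * - ln r.
Proof.
move=> /andP[t0 t1] r0; rewrite ln_div ?posrE ?powR_gt0// ln_powR; ring.
Qed.

Lemma power_lt (theta r : R) : 0 < theta < 1 -> 0 < r < 1 -> r `^ theta^-1 < r.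
Proof.
move=> /andP[t0 t1] /andP[r0 r1].
rewrite -ltr_ln ?posrE ?powR_gt0// ln_powR -subr_gt0.
have -> : ln r - theta^-1 * ln r = (theta^-1 - 1) * - ln r by ring.
rewrite mulr_gt0// ?subr_gt0 ?invf_gt1// oppr_gt0 -ln1 ltr_ln ?posrE//.
Qed.

Lemma growth_estimate_power theta : 0 < theta < 1 -> exists C : R, forall r,
  0 < r < 1 -> exists2 g : R, growth r (r `^ theta^-1) = g%:E &
    `|g - spectrum_dim theta * ln (r / r `^ theta^-1)| <= C.
Proof.
move=> t01; have [C HC] := growth_estimate; exists C => r /andP[r0 r1].
have rr : r `^ theta^-1 < r by apply: power_lt => //; rewrite r0.
have [g gE gC] := HC _ _ (powR_gt0 theta^-1 r0) (ltW rr); exists g => //.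
move: gC; rewrite !neg_log_lt1 ?(lt_trans rr)// ln_powR -mulrN.
rewrite growth_exponent_power// ?ln_power_ratio// 1?mulrC//.
by rewrite oppr_ge0 ln_le0// ltW.
Qed.

Lemma exists_power_ratio (theta T : R) : 0 < theta < 1 -> 0 < T ->
  exists2 r : R, 0 < r < 1 & ln (r / r `^ theta^-1) = T.
Proof.
move=> t01 T0; have /andP[t0 t1] := t01.
have d0 : 0 < theta^-1 - 1 by rewrite subr_gt0 invf_gt1.
exists (expR (- (T / (theta^-1 - 1)))).
  by rewrite expR_gt0 expR_lt1 oppr_lt0 divr_gt0.
rewrite ln_power_ratio ?expR_gt0// expRK opprK mulrC divfK// gt_eqF//.
Qed.

Theorem mdimA_spectrum_carpet theta : 0 < theta < 1 ->
  mdimA_spectrum X (@shift_pair R) carpet_dist theta = (spectrum_dim theta)%:E.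
Proof.
move=> t01; have [C HC] := growth_estimate_power t01.
apply: (@inf_exponents R R (fun r => 0 < r < 1)
  (fun r => growth r (r `^ theta^-1)) (fun r => r / r `^ theta^-1) _ C).
- exact: spectrum_dim_ge0.
- move=> r r01; have /andP[r0 r1] := r01.
  by rewrite ler_pdivlMr ?powR_gt0// mul1r ltW// power_lt.
- move=> r r01; have [g gE] := HC r r01; rewrite ler_distl => /andP[_ h1].
  by exists g => //; rewrite addrC.
move=> T T0; have [r r01 rT] := exists_power_ratio t01 T0.
exists r; split=> //; have [g gE] := HC r r01.
by rewrite ler_distl rT => /andP[h1 _]; exists g.
Qed.

Theorem mdimA_carpet :
  mdimA X (@shift_pair R) carpet_dist = assouad_dim%:E.
Proof.
(* For this [theta] no level has two free digits, so the spectrum already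
   attains the slope that bounds the growth for all pairs of scales. *)
pose theta := lb / la.
have t01 : 0 < theta < 1 by rewrite divr_gt0//= ltr_pdivrMr// mul1r.
have tD : spectrum_dim theta = assouad_dim.
  rewrite /spectrum_dim (_ : Num.max 0 _ = 0) ?mul0r ?subr0//.
  apply/max_idPl; rewrite /theta subr_le0 mulrAC divff ?mul1r//.
  by rewrite gt_eqF.
have [C1 HC1] := growth_estimate_power t01; have [C2 HC2] := growth_estimate.
have inf := @inf_exponents R (R * R)%type (fun i => 0 < i.1 < i.2)
  (fun i => growth i.2 i.1) (fun i => i.2 / i.1) assouad_dim (Num.max C1 C2).
rewrite -inf.
- congr ereal_inf; apply/seteqP; split=> _ [s [s0 [C C0 HC]] <-]; exists s => //.
    by split => //; exists C => // -[rho r] /= rr; exact: HC.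
  by split => //; exists C => // rho r rr; exact: (HC (rho, r)).
- by rewrite addr_ge0// divr_ge0// ltW.
- by move=> [rho r] /= /andP[rho0 rr]; rewrite ler_pdivlMr// mul1r ltW.
- move=> [rho r] /= /andP[rho0 rr]; have [g gE] := HC2 r rho rho0 (ltW rr).
  rewrite ler_distl => /andP[_ h1]; exists g => //; apply: le_trans h1 _.
  rewrite addrC lerD ?le_max ?lexx ?orbT//.
  apply: le_trans (growth_exponent_le (neg_log_le rho0 (ltW rr))) _.
  rewrite mulrC ler_wpM2l ?neg_log_sub_le ?(ltW rr)//.
  by rewrite addr_ge0// divr_ge0// ltW.
move=> T T0; have [r r01 rT] := exists_power_ratio t01 T0.
exists (r `^ theta^-1, r) => /=; have /andP[r0 r1] := r01.
have [g gE] := HC1 r r01; rewrite tD rT ler_distl => /andP[h1 _].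
split; [by rewrite powR_gt0// power_lt|by []|exists g => //].
by apply: le_trans h1; rewrite lerD2l lerN2 le_max lexx.
Qed.

Definition metric_dim : R := h / la + (lb^-1 - la^-1) * h'.

Lemma mdimM_at_cvg :
  mdimM_at X (@shift_pair R) carpet_dist @ 0^'+ --> metric_dim%:E.
Proof.
have [C HC] := local_growth_estimate R b1 ab hsub hne.
have C0 : 0 <= C.
  by have [g _ /(le_trans (normr_ge0 _))] := HC 1 1 ltr01 (lexx 1).
have O_shift w : Omega w -> Omega (shift_seq w).
  by move=> Ow; apply: hsub.2; exists w.
have cm := carpet_coordinate_metric R (ltn_trans b1 ab) b1 O_shift.
have [w0 Ow0] := hne.
have Xp : X (coded_point R (cst w0)).
  by apply: coded_point_carpet => //; exact: ltn_trans ab.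
(* The ball of radius 1 is the whole carpet, so the metric mean dimension is the
   local growth at [r = 1]. *)
have sup1 e M : max_log_cover Omega 1 e M = log_cover X (@shift_pair R) carpet_dist M X e.
  have ball1 x : X x -> cball_in X (bowen_dist (@shift_pair R) carpet_dist M) x 1 = X.
    move=> Xx; apply/seteqP; split=> [y []//|y Xy]; split => //.
    exact: (bowen_dist_le1 cm).
  rewrite /max_log_cover (_ : [set _ | x in X] =
    [set log_cover X (@shift_pair R) carpet_dist M X e]) ?ereal_sup1//.
  apply/seteqP; split=> [_ [x Xx <-] /=|_ ->]; first by rewrite ball1.
  by exists (coded_point R (cst w0)); rewrite ?ball1.
have dimE e : 0 < e < 1 -> exists2 g : R,
    mdimM_at X (@shift_pair R) carpet_dist e = (g / - ln e)%:E &
    `|g - metric_dim * - ln e| <= C.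
  move=> /andP[e0 e1]; have [g gc gC] := HC 1 e e0 (ltW e1); exists g.
    rewrite /mdimM_at lnV ?posrE//; apply/cvg_lim => //.
    have -> : (fun M : nat => log_cover X (@shift_pair R) carpet_dist M X e *
        ((M%:R * - ln e)^-1)%:E)%E =
      (fun M : nat => ((M%:R^-1)%:E * max_log_cover Omega 1 e M) * ((- ln e)^-1)%:E)%E.
      by apply/funext => M; rewrite sup1 invfM EFinM muleA [X in (X * _)%E]muleC.
    by rewrite EFinM; apply: cvgeZr.
  move: gC; rewrite (neg_log_lt1 e1).
  have -> : neg_log (1 : R) = 0 by rewrite /neg_log minxx ln1 oppr0.
  rewrite /growth_exponent mul0r !subr0 (_ : Num.max 0 _ = - ln e / la).
    rewrite (_ : - ln e * (hc / la + h' / lb) - - ln e / la * Delta = metric_dim * - ln e)//.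
    by rewrite /metric_dim; ring.
  by apply/max_idPr; rewrite divr_ge0 ?(ltW la0)// oppr_ge0 ln_le0// ltW.
apply/fine_cvgP; split.
  near=> e; have [|g -> _] := dimE e; last by [].
  by apply/andP; split; near: e; [exact: nbhs_right_gt|exact: nbhs_right_lt].
apply/cvgrPdist_le => eps eps0; near=> e.
have e0 : 0 < e by near: e; exact: nbhs_right_gt.
have e1 : e < 1 by near: e; exact: nbhs_right_lt.
have [|g gE gC] := dimE e; first by rewrite e0.
have t0 : 0 < - ln e by rewrite oppr_gt0 ln_lt0// e0.
have Ct : C <= eps * - ln e.
  rewrite mulrC -ler_pdivrMr// lerNr -[leRHS]expRK ler_ln ?posrE ?expR_gt0//.
  by near: e; apply: nbhs_right_le; exact: expR_gt0.
rewrite /comp gE /= distrC.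
have -> : g / - ln e - metric_dim = (g - metric_dim * - ln e) / - ln e.
  by rewrite mulrBl mulfK// gt_eqF.
rewrite normrM normfV [X in _ / X]gtr0_norm// ler_pdivrMr//.
exact: le_trans gC Ct.
Unshelve. all: by end_near.
Qed.

Theorem mdimM_carpet : mdimM X (@shift_pair R) carpet_dist = metric_dim%:E.
Proof.
have [up low] := limf_esup_einf_cvg mdimM_at_cvg.
rewrite /mdimM.
have [<- _] := @getPex _ [set v | upper_mdimM X (@shift_pair R) carpet_dist = v /\
  lower_mdimM X (@shift_pair R) carpet_dist = v]
  (ex_intro _ metric_dim%:E (conj up low)).
exact: up.
Qed.

(** The first term of the minimum is the Assouad dimension minus the loss without
    truncation at 0. Since [Delta] is nonnegative, truncating the factor of [Delta]
    at 0 is the same as taking the minimum with the Assouad dimension. *)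
Lemma spectrum_dim_min theta : 0 < theta < 1 -> spectrum_dim theta =
  Num.min ((metric_dim - theta * ((la^-1 - lb^-1) * hc + h * lb^-1)) *
    (1 - theta)^-1) assouad_dim.
Proof.
move=> /andP[t0 t1]; have t10 : 0 < 1 - theta by rewrite subr_gt0.
have -> : (metric_dim - theta * ((la^-1 - lb^-1) * hc + h * lb^-1)) *
    (1 - theta)^-1 = assouad_dim - (la^-1 - theta / lb) * Delta / (1 - theta).
  rewrite /metric_dim /assouad_dim; set x := la^-1; set y := lb^-1.
  by field; rewrite gt_eqF.
rewrite /spectrum_dim; have [le0|gt0] := leP (la^-1 - theta / lb) 0.
  rewrite !mul0r subr0; apply/esym/min_idPr; rewrite lerDl oppr_ge0.
  by rewrite -mulrA mulr_le0_ge0// divr_ge0// ltW.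
apply/esym/min_idPl; rewrite gerDl oppr_le0 -mulrA mulr_ge0 ?(ltW gt0)//.
by rewrite divr_ge0// ltW.
Qed.

End Dimensions.

Theorem theorem5p2 (R : realType) (a b : nat)
    (Omega : set (nat -> 'I_a * 'I_b))
    (hb : (2 <= b)%N) (hab : (b < a)%N)
    (hsub : subshift Omega) (hne : Omega !=set0) :
  let Omega' : set (nat -> 'I_b) := proj2 @` Omega in
  let X : set ((nat -> R) * (nat -> R)) := carpet R Omega in
  let dimA := mdimA X shift_pair carpet_dist in
  let dimM := mdimM X shift_pair carpet_dist in
  let h : \bar R := htop Omega shift_seq (symb_dist R) in
  let h' : \bar R := htop Omega' shift_seq (symb_dist R) in
  let hcond : \bar R :=
    htop_cond Omega shift_seq (symb_dist R) Omega' proj2 in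
  (dimA = hcond * ((ln a%:R)^-1)%:E + h' * ((ln b%:R)^-1)%:E)%E /\
  forall theta : R, 0 < theta < 1 ->
    (mdimA_spectrum X shift_pair carpet_dist theta =
     Order.min
       ((dimM - theta%:E *
           (((ln a%:R)^-1 - (ln b%:R)^-1)%:E * hcond + h * ((ln b%:R)^-1)%:E))
        * ((1 - theta)^-1)%:E)
       dimA)%E.
Proof.
move=> Omega' X dimA dimM h h' hcond.
have hE : h = (h_omega R Omega)%:E.
  by apply: htop_symb => // w Ow; apply: hsub.2; exists w.
have h'E : h' = (h_proj R Omega)%:E.
  apply: htop_symb => [_ [w Ow <-]|].
    by exists (shift_seq w) => //; apply: hsub.2; exists w.
  by have [w Ow] := hne; exists (proj2 w), w.
have hcondE : hcond = (h_fibre R Omega)%:E by exact: htop_cond_symb.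
have dimAE : dimA = (assouad_dim R Omega)%:E by exact: mdimA_carpet.
have dimME : dimM = (metric_dim R Omega)%:E by exact: mdimM_carpet.
split=> [|theta t01]; first by rewrite dimAE hcondE h'E -!EFinM -EFinD.
rewrite mdimA_spectrum_carpet// spectrum_dim_min// dimAE dimME hE hcondE.
by rewrite -!EFinM EFin_min.
Qed.
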